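(* Assume the setting in the context and fix positive integers $m,D,L$. For every $\delta\in(0,1)$ and $n\ge1$, with probability at least $1-\delta$ over the choice of the i.i.d. sample $\mathcal S$ of size $n$, simultaneously for all families $\Theta=\{\theta(a)\}_{a\in A}$ in which each $f(\cdot,\theta(a))$ is a residual network of size $(d,m,D,L)$, $$\big|\mathcal R_{\mathcal D}(\Theta)-\mathcal R_{\mathcal S}(\Theta)\big|\le\frac{(\|\Theta\|_{\mathcal P}+1)^2}{\sqrt n}\Big(36|A|^3\sqrt{2\ln(2d)}+\frac92\Big(\ln\big(4(\|\Theta\|_{\mathcal P}+1)\big)+\ln(|A|/\delta)\Big)\Big).$$
   Context: Residual networks: for positive integers $d,m,D,L$, a residual network of size $(d,m,D,L)$ is a function $f(\cdot,\theta):\mathbb R^d\to\mathbb R$, $f(x,\theta)=u^{\top}h^{[L]}$, where $h^{[0]}=Vx$ and $h^{[l]}=h^{[l-1]}+U^{[l]}\sigma(W^{[l]}h^{[l-1]})$ for $l=1,\dots,L$, with $V\in\mathbb R^{D\times d}$, $W^{[l]}\in\mathbb R^{m\times D}$, $U^{[l]}\in\mathbb R^{D\times m}$, $u\in\mathbb R^D$, $\sigma(z)=\max(z,0)$ applied entrywise, and $\theta=(u,V,\{W^{[l]}\}_{l=1}^L,\{U^{[l]}\}_{l=1}^L)$. Its weighted path norm is $\|\theta\|_{\mathcal P}=\big\||u|^{\top}(I+3|U^{[L]}||W^{[L]}|)\cdots(I+3|U^{[1]}||W^{[1]}|)|V|\big\|_1$, where $|\cdot|$ of a matrix/vector is entrywise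 absolute value and $I$ is the $D\times D$ identity. For a family $\Theta=\{\theta(a)\}_{a\in A}$ of parameters (one network per action, all of the same size), $f(s,\theta(a))$ denotes the $a$-th network and $\|\Theta\|_{\mathcal P}=\sum_{a\in A}\|\theta(a)\|_{\mathcal P}$. Setting: $S\subseteq[0,1]^d$ is compact with positive Lebesgue measure (state space); $A$ is a finite action set with $|A|=2^{\alpha}$, $\alpha\ge 0$ an integer, identified with $\{1,\dots,2^\alpha\}$; $\gamma\in(0,1)$. The reward $r:S\times A\to\mathbb R$ satisfies: each $r(\cdot,a)$ is continuous and $|r(s,a)|\le 1$ for all $(s,a)$. The transition is a map $\tilde g:S\times A\times[0,\infty)\to S$, and a time step $\Delta t\in(0,1)$ is fixed. $\mathcal D$ is the uniform distribution on $S$ and $\mathcal U$ the uniform distribution on $A$. Losses: the Bellman optimal loss is $\mathcal R_{\mathcal D}(\Theta)=\frac12\mathbb E_{s\sim\mathcal D,a\sim\mathcal U}\big(f(s,\theta(a))-r(s,a)-\gamma\max_{a'\in A}f(s',\theta(a'))\big)^2$ with $s'=\tilde g(s,a,\Delta t)$. A sample $\mathcal S=\{(s_i,a_i,s_i')\}_{i=1}^n$ consists of i.i.d. pairs $s_i\sim\mathcal D$, $a_i\sim\mathcal U$ (independent) with $s_i'=\tilde g(s_i,a_i,\Delta t)$; the empirical loss is $\mathcal R_{\mathcal S}(\Theta)=\frac1{2n}\sum_{i=1}^n\big(f(s_i,\theta(a_i))-r(s_i,a_i)-\gamma\max_{a'\in A}f(s_i',\theta(a'))\big)^2$. *)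

(* Defs.v *)
From HB Require Import structures.
From mathcomp Require Import all_boot all_order all_algebra.
From mathcomp Require Import all_classical all_reals all_analysis.
Set Implicit Arguments.
Unset Strict Implicit.
Unset Printing Implicit Defensive.
Import Order.TTheory GRing.Theory Num.Theory.
Import numFieldNormedType.Exports.
Local Open Scope classical_set_scope.
Local Open Scope ring_scope.

Section Defs.
Variable R : realType.

Definition Rd (d : nat) := g_sigma_algebraType (@open 'cV[R]_d).

(* [lam] agrees with the d-dimensional Lebesgue measure on boxes; since boxes
   generate the Borel sets, such a measure is the Lebesgue measure on Borel sets. *)
Definition lebesgue_on_boxes (d : nat) (lam : {measure set (Rd d) -> \bar R}) :=
  forall a b : 'cV[R]_d, (forall i, a i 0 <= b i 0) ->
    lam [set x : Rd d | forall i, a i 0 <= x i 0 <= b i 0] =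
    (\prod_(i < d) (b i 0 - a i 0))%:E.

(* parameters theta = (u, V, {W^[l]}_{l=1..L}, {U^[l]}_{l=1..L});
   layer l (1 <= l <= L) is stored at index l-1 : 'I_L *)
Record resnet_param (d m D L : nat) := ResnetParam {
  par_u : 'cV[R]_D;
  par_V : 'M[R]_(D, d);
  par_W : 'I_L -> 'M[R]_(m, D);
  par_U : 'I_L -> 'M[R]_(D, m) }.

Definition relu (z : R) : R := Num.max z 0.

Definition resnet_hidden d m D L (th : resnet_param d m D L) (x : 'cV[R]_d)
  : 'cV[R]_D :=
  foldl (fun h l => h + par_U th l *m map_mx relu (par_W th l *m h))
        (par_V th *m x) (enum 'I_L).

Definition resnet d m D L (th : resnet_param d m D L) (x : 'cV[R]_d) : R :=
  ((par_u th)^T *m resnet_hidden th x) 0 0.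

Definition mabs p q (M : 'M[R]_(p, q)) : 'M[R]_(p, q) := map_mx (fun z => `|z|) M.

Definition path_norm d m D L (th : resnet_param d m D L) : R :=
  let v := foldl (fun v l => v *m (1%:M + 3%:R *: (mabs (par_U th l) *m mabs (par_W th l))))
                 (mabs (par_u th))^T (rev (enum 'I_L)) in
  \sum_(j < d) `|(v *m mabs (par_V th)) 0 j|.

Lemma pow2_gt0 (alpha : nat) : (0 < 2 ^ alpha)%N.
Proof. by rewrite expn_gt0. Qed.

(* action set A = {1,...,2^alpha}, represented as 'I_(2^alpha) *)
Definition act0 (alpha : nat) : 'I_(2 ^ alpha) := Ordinal (pow2_gt0 alpha).

Definition act_family d m D L alpha := 'I_(2 ^ alpha) -> resnet_param d m D L.

Definition family_path_norm d m D L alpha (Th : act_family d m D L alpha) : R :=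
  \sum_(a < 2 ^ alpha) path_norm (Th a).

Definition max_Q d m D L alpha (Th : act_family d m D L alpha) (s : 'cV[R]_d) : R :=
  \big[Num.max/resnet (Th (act0 alpha)) s]_(a < 2 ^ alpha) resnet (Th a) s.

Definition bellman_sq d m D L alpha (gamma dt : R)
  (r : 'cV[R]_d -> 'I_(2 ^ alpha) -> R)
  (gt : 'cV[R]_d -> 'I_(2 ^ alpha) -> R -> 'cV[R]_d)
  (Th : act_family d m D L alpha) (s : 'cV[R]_d) (a : 'I_(2 ^ alpha)) : R :=
  (resnet (Th a) s - r s a - gamma * max_Q Th (gt s a dt)) ^+ 2.

Definition risk_D d m D L alpha (S : set 'cV[R]_d)
  (lam : {measure set (Rd d) -> \bar R}) (gamma dt : R)
  (r : 'cV[R]_d -> 'I_(2 ^ alpha) -> R)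
  (gt : 'cV[R]_d -> 'I_(2 ^ alpha) -> R -> 'cV[R]_d)
  (Th : act_family d m D L alpha) : R :=
  2^-1 * ((2 ^ alpha)%:R^-1 * \sum_(a < 2 ^ alpha)
     (fine (lam S))^-1 *
     fine (\int[lam]_(s in (S : set (Rd d)))
              (bellman_sq gamma dt r gt Th s a)%:E)).

Definition risk_S d m D L alpha n (gamma dt : R)
  (r : 'cV[R]_d -> 'I_(2 ^ alpha) -> R)
  (gt : 'cV[R]_d -> 'I_(2 ^ alpha) -> R -> 'cV[R]_d)
  (s : 'I_n -> 'cV[R]_d) (a : 'I_n -> 'I_(2 ^ alpha))
  (Th : act_family d m D L alpha) : R :=
  (2 * n%:R)^-1 * \sum_(i < n) bellman_sq gamma dt r gt Th (s i) (a i).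

(* (s_i, a_i)_{i<n} are i.i.d. on the probability space (Omega, P):
   s_i ~ uniform on S, a_i ~ uniform on A, and all 2n variables are
   mutually independent (product rule for measurable rectangles; taking
   full sets gives the product rule for every subfamily). *)
Definition iid_sample d alpha n dO (Omega : measurableType dO)
  (P : probability Omega R) (S : set 'cV[R]_d)
  (lam : {measure set (Rd d) -> \bar R})
  (ss : 'I_n -> Omega -> Rd d) (aa : 'I_n -> Omega -> 'I_(2 ^ alpha)) : Prop :=
  [/\ (forall i, measurable_fun setT (ss i)),
      (forall i a, measurable (aa i @^-1` [set a])),
      (forall i (B : set (Rd d)), measurable B ->
          P (ss i @^-1` B) = (fine (lam (B `&` S)) / fine (lam S))%:E),
      (forall i a, P (aa i @^-1` [set a]) = ((2 ^ alpha)%:R^-1)%:E) &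
      (forall (B : 'I_n -> set (Rd d)) (C : 'I_n -> set 'I_(2 ^ alpha)),
          (forall i, measurable (B i)) ->
          P [set w | forall i, B i (ss i w) /\ C i (aa i w)] =
          \big[*%E/1%E]_(i < n) (P (ss i @^-1` B i) * P (aa i @^-1` C i))%E)].

Definition gen_bound d alpha (n : nat) (delta pn : R) : R :=
  (pn + 1) ^+ 2 / Num.sqrt n%:R *
  (36%:R * (2 ^ alpha)%:R ^+ 3 * Num.sqrt (2 * ln (2 * d%:R)) +
   9%:R / 2 * (ln (4 * (pn + 1)) + ln ((2 ^ alpha)%:R / delta))).

End Defs.

(* Main.v *)
(* A single finite model carries the whole statement.  The observable data
   (coordinates of [s], rewards, coordinates of the next states) are rounded to a
   mesh of size 1/(40 n); this partitions S into finitely many measurable cells, and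
   since networks are Lipschitz with constant their path norm, both risks move by at
   most M^2/(40 n), M = 2 B + 1, when every point is replaced by a representative of
   its cell.  In the finite model the supremum of the deviation over families of path
   norm at most B is controlled by McDiarmid's inequality, symmetrization, the
   contraction principle (square, maximum over actions, ReLU) and a bound
   3 B sqrt(2 n ln(2d)) for the sign averages of residual networks.  The latter comes
   from a gauge for which a network of path norm q lies in q times the unit ball: the
   sign average of the (l+1)-st ball is at most C + (2/3) times that of the l-th one,
   C = sqrt(2 n ln(2d)), and 3 C is a fixed point of this recursion, which is why the
   path norm has weight 3.  Finally the integers B = k + 1 are given failure
   probability delta/(B (B + 1)), and B is the first integer above the path norm. *)
Require Import Defs.
From HB Require Import structures.
From mathcomp Require Import all_boot all_order all_algebra.
From mathcomp Require Import all_classical all_reals all_analysis.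
From mathcomp Require Import measurable_realfun ring lra.
Set Implicit Arguments.
Unset Strict Implicit.
Unset Printing Implicit Defensive.
Import Order.TTheory GRing.Theory Num.Theory.
Import numFieldNormedType.Exports.
Local Open Scope classical_set_scope.
Local Open Scope ring_scope.

(** * Exponential moments *)

(** Two obstacles shape the proof: uncountably many families compete, and the transition is only
    measurable in the state. Rounding meets both. The good event becomes a finite union of sample
    cells, so no supremum has to be measurable; and the next states are rounded themselves, so no
    modulus of continuity of the transition enters. Expectations become finite sums defined by
    recursion on the sample, and independence arguments become inductions on it. The unit balls are
    described through linear forms because a sign sum of point evaluations is such a form: inserting
    it into the definition bounds its supremum over a ball by coordinates and by the previous ball,
    and no convex combination is ever written. Constants: the square has Lipschitz constant 2 M, the
    action value and the maximum cost a factor |A| each, and networks contribute 3 B, whence 2 M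
    (|A| + |A|) 3 B = 12 |A| M B; the 2 of symmetrization cancels the 1/2 of the loss. With Q the
    path norm and B <= Q + 1, M B <= 3 (Q + 1)^2 turns 12 into 36, and M^2 <= 9 (Q + 1)^2 gives
    9/2. *)

Section Exponential.
Variable R : realType.
Implicit Types c h x y : R.

(** Convexity from tangents alone: the tangent at [h * y] lies below the exponential at 0 and at
    [h], and the two inequalities are averaged with weights [1 - y] and [y]. *)
Lemma expR_chord h y : 0 <= y <= 1 -> expR (h * y) <= 1 - y + y * expR h.
Proof.
move=> /andP[y0 y1]; set z := h * y.
have Eh : expR z * (1 + (h - z)) <= expR h.
  rewrite -{2}(subrKC z h) expRD ler_pM2l ?expR_gt0//; exact: expR_ge1Dx.
have E0 : expR z * (1 - z) <= 1.
  have := ler_wpM2l (expR_ge0 z) (expR_ge1Dx (- z)); rewrite -expRD subrr expR0; exact.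
have -> : expR z = (1 - y) * (expR z * (1 - z)) + y * (expR z * (1 + (h - z))).
  by rewrite /z; ring.
rewrite lerD// ?ler_wpM2l//.
by rewrite -[leRHS]mulr1 ler_wpM2l// subr_ge0.
Qed.

Lemma fact_double_ge (k : nat) : (2 ^ k * k`! <= (k.*2)`!)%N.
Proof.
elim: k => // k ih; rewrite doubleS !factS expnS.
have -> : (2 * 2 ^ k * (k.+1 * k`!) = k.+1.*2 * (2 ^ k * k`!))%N.
  by rewrite -mul2n; ring.
rewrite -doubleS leq_mul//; apply: leq_trans ih _.
by rewrite leq_pmull.
Qed.

(* The power series of [cosh y] is dominated termwise by that of [expR (y ^+ 2 / 2)],
   because [(2k)! >= 2 ^ k * k!]. *)
Lemma expRDexpRN_le y : expR y + expR (- y) <= 2 * expR (y ^+ 2 / 2).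
Proof.
have Cv x : series (exp_coeff x) n @[n --> \oo] --> expR x.
  exact: is_cvg_series_exp_coeff.
(* Only partial sums of even length are compared, so that each induction step adds one even term and
   one odd term, and the odd terms of [y] and [- y] cancel. *)
have Cv2 x : series (exp_coeff x) n.*2 @[n --> \oo] --> expR x.
  apply: (cvg_comp _ _ _ (Cv x)) => A [N _ NA]; exists N => // n /= Nn.
  by apply: NA => /=; rewrite (leq_trans Nn)// -addnn leq_addr.
have L : series (exp_coeff y) n.*2 + series (exp_coeff (- y)) n.*2 @[n --> \oo] -->
    expR y + expR (- y) by exact: cvgD.
have G : 2 * series (exp_coeff (y ^+ 2 / 2)) n @[n --> \oo] --> 2 * expR (y ^+ 2 / 2).
  by apply: cvgM => //; exact: cvg_cst.
apply: (ler_cvg_to L G); near=> n => /=; elim: (n) => [|k ih].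
  by rewrite /series /= !big_geq// mulr0 addr0.
rewrite doubleS /series /= !big_nat_recr//= in ih *.
rewrite -/(series _ _) -/(series _ _) in ih *.
have e1 : exp_coeff y k.*2.+1 + exp_coeff (- y) k.*2.+1 = 0.
  by rewrite /exp_coeff /= !exprS -mul2n !exprM sqrrN; ring.
have e2 : exp_coeff y k.*2 + exp_coeff (- y) k.*2 <= 2 * exp_coeff (y ^+ 2 / 2) k.
  rewrite /exp_coeff /= -mul2n !exprM sqrrN expr_div_n -mulr2n -[(_ / _) *+ 2]mulr_natl ler_pM2l//.
  rewrite -!mulrA ler_wpM2l ?(exprn_ge0 _ (sqr_ge0 y))//.
  rewrite -invfM.
  rewrite lef_pV2 ?posrE ?mulr_gt0 ?exprn_gt0 ?ltr0n ?fact_gt0//.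
  by rewrite -natrX -natrM ler_nat mul2n fact_double_ge.
rewrite mulrDr; apply: le_trans (lerD ih e2).
by rewrite le_eqVlt; apply/orP; left; apply/eqP; move: e1; lra.
Unshelve. all: by end_near. Qed.

End Exponential.

(** * McDiarmid's inequality for finite product weights *)

Section Concentration.
Variables (R : realType) (X : finType) (p : X -> R).

(** The expectation over [n] independent draws with weights [p]. The first draw is summed outermost
    and [F] takes lists, so that conditioning on it is just [fun s => F (x :: s)], without casts. *)
Fixpoint iid_mean (n : nat) (F : seq X -> R) : R :=
  if n is n'.+1 then \sum_x p x * iid_mean n' (fun s => F (x :: s)) else F [::].

Lemma iid_meanZ n a F : iid_mean n (fun s => a * F s) = a * iid_mean n F.
Proof.
elim: n F => //= n ih F; rewrite mulr_sumr; apply: eq_bigr => x _.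
by rewrite ih mulrCA.
Qed.

Lemma iid_mean_sum n (I : Type) (r : seq I) (F : I -> seq X -> R) :
  iid_mean n (fun s => \sum_(i <- r) F i s) = \sum_(i <- r) iid_mean n (F i).
Proof.
elim: n F => //= n ih F; rewrite exchange_big/=; apply: eq_bigr => x _.
by rewrite ih mulr_sumr.
Qed.

Lemma iid_meanD n F G : iid_mean n (fun s => F s + G s) = iid_mean n F + iid_mean n G.
Proof.
elim: n F G => //= n ih F G; rewrite -big_split/=; apply: eq_bigr => x _.
by rewrite ih mulrDr.
Qed.

(** The bridge to the probability space: these products of weights are the probabilities of the
    sample cells. *)
Lemma iid_mean_tuple n F :
  iid_mean n F = \sum_(t : n.-tuple X) (\prod_(i < n) p (tnth t i)) * F t.
Proof.
elim: n F => [|n ih] F /=.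
  rewrite (big_pred1 [tuple]) ?big_ord0 ?mul1r// => t.
  by apply/esym/eqP; exact: tuple0.
under eq_bigr do rewrite ih mulr_sumr.
rewrite pair_bigA /= (reindex (fun t : n.+1.-tuple X => (thead t, [tuple of behead t])))/=.
  apply: eq_bigr => t _.
  rewrite big_ord_recl mulrA; congr (_ * _ * F _); last by case/tupleP: t.
  by apply: eq_bigr => i _; rewrite tnth_behead; congr (p (tnth t _)); apply/val_inj;
    rewrite /= inordK// ltnS.
exists (fun u : X * n.-tuple X => [tuple of u.1 :: u.2]) => [t _|[x t] _] /=.
  by case/tupleP: t => x t; apply/val_inj.
by congr pair; apply/val_inj.
Qed.

Hypothesis p_ge0 : forall x, 0 <= p x.

Lemma iid_mean_le n F G : (forall s, size s = n -> F s <= G s) -> iid_mean n F <= iid_mean n G.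
Proof.
elim: n F G => [|n ih] F G FG /=; first exact: FG.
by apply: ler_sum => x _; rewrite ler_wpM2l//; apply: ih => s sn; apply: FG; rewrite /= sn.
Qed.

Hypothesis p_sum : \sum_x p x = 1.

Lemma iid_mean_cst n c : iid_mean n (fun=> c) = c.
Proof. by elim: n => //= n ->; rewrite -mulr_suml p_sum mul1r. Qed.

(** Jensen's inequality, from the tangent of the exponential at the mean. *)
Lemma expR_mean_le (f : X -> R) : expR (\sum_x p x * f x) <= \sum_x p x * expR (f x).
Proof.
set mu := \sum_x p x * f x.
have -> : expR mu = \sum_x p x * (expR mu * (1 + (f x - mu))).
  under eq_bigr do rewrite mulrCA.
  rewrite -mulr_sumr; under eq_bigr do rewrite addrC -addrA mulrDr.
  rewrite big_split/= -/mu -mulr_suml p_sum mul1r -[LHS]mulr1; congr (_ * _).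
  by ring.
apply: ler_sum => x _.
rewrite ler_wpM2l// -{2}(subrKC mu (f x)) expRD ler_pM2l ?expR_gt0//.
exact: expR_ge1Dx.
Qed.

(* A weak form of Hoeffding's lemma (1/4 instead of 1/8).  With q the rescaled
   mean, the chord bound gives
   [E e^f E e^-f <= (1 - q + q e^c) (1 - q + q e^-c) <= cosh (c / 2) ^ 2]. *)
Lemma expR_bounded_diff (f : X -> R) (c : R) : 0 < c -> (forall x y, f x - f y <= c) ->
  \sum_x p x * expR (f x) <= expR (\sum_x p x * f x + c ^+ 2 / 4).
Proof.
move=> c0 fc.
have [x0 _] : exists x0 : X, true.
  apply: contrapT => nX; move: p_sum; rewrite big1 => [/eqP|x _].
    by rewrite eq_sym oner_eq0.
  by exfalso; apply: nX; exists x.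
pose a := f [arg min_(x < x0) f x]%O.
have af x : a <= f x by rewrite /a; case: arg_minP => // i _; exact.
pose y x := (f x - a) / c.
have y01 x : 0 <= y x <= 1.
  by rewrite /y divr_ge0 ?subr_ge0 ?(ltW c0)//= ler_pdivrMr// mul1r fc.
have fE x : f x = a + c * y x by rewrite /y mulrC divfK ?gt_eqF// subrKC.
pose q := \sum_x p x * y x.
have chord h : \sum_x p x * expR (h * y x) <= 1 - q + q * expR h.
  rewrite -p_sum /q -sumrB mulr_suml -big_split/=; apply: ler_sum => x _.
  have -> : p x - p x * y x + p x * y x * expR h = p x * (1 - y x + y x * expR h) by ring.
  by rewrite ler_wpM2l// expR_chord.
have q01 : 0 <= q <= 1.
  rewrite sumr_ge0 => [|x _]; last by rewrite mulr_ge0//; case/andP: (y01 x).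
  rewrite -p_sum; apply: ler_sum => x _.
  by rewrite -[leRHS]mulr1 ler_wpM2l//; case/andP: (y01 x).
have mE : \sum_x p x * f x = a + c * q.
  rewrite /q mulr_sumr -[a]mul1r -p_sum mulr_suml -big_split/=.
  by apply: eq_bigr => x _; rewrite fE; ring.
have -> : \sum_x p x * expR (f x) = expR a * \sum_x p x * expR (c * y x).
  by rewrite mulr_sumr; apply: eq_bigr => x _; rewrite fE expRD; ring.
rewrite mE -addrA expRD ler_pM2l ?expR_gt0//.
have Jq : expR (- (c * q)) <= \sum_x p x * expR (- c * y x).
  have := expR_mean_le (fun x => - c * y x); congr (expR _ <= _).
  by rewrite -mulNr /q mulr_sumr; apply: eq_bigr => x _; ring.
have Jq' := le_trans Jq (chord (- c)).
have Cc := chord c.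
rewrite expRD -ler_pdivrMl ?expR_gt0// -expRN.
have E1 : expR (c / 2) * expR (- (c / 2)) = 1 by rewrite -expRD subrr expR0.
have Ep : expR c = expR (c / 2) ^+ 2 by rewrite expr2 -expRD; congr expR; lra.
have Em : expR (- c) = expR (- (c / 2)) ^+ 2 by rewrite expr2 -expRD; congr expR; lra.
have ch := expRDexpRN_le (c / 2).
have E4 : expR (c ^+ 2 / 4) = expR ((c / 2) ^+ 2 / 2) ^+ 2.
  by rewrite [RHS]expr2 -expRD; congr expR; field.
rewrite E4.
set w := expR ((c / 2) ^+ 2 / 2) in ch *.
set e := expR (c / 2) in E1 Ep ch; set e' := expR (- (c / 2)) in E1 Em ch.
have e0 : 0 < e by exact: expR_gt0.
have e'0 : 0 < e' by exact: expR_gt0.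
apply: le_trans (_ : (1 - q + q * expR (- c)) * (1 - q + q * expR c) <= _).
  apply: ler_pM => //.
  by apply: sumr_ge0 => x _; rewrite mulr_ge0 ?expR_ge0.
rewrite Ep Em.
have -> : (1 - q + q * e' ^+ 2) * (1 - q + q * e ^+ 2) =
   1 + q * (1 - q) * (e ^+ 2 + e' ^+ 2 - 2) + q ^+ 2 * ((e * e') ^+ 2 - 1) by ring.
rewrite E1 expr1n subrr mulr0 addr0.
have sq : e ^+ 2 + e' ^+ 2 - 2 = (e - e') ^+ 2 by rewrite -[2]mulr1 -{2}E1; ring.
have qq : q * (1 - q) <= 4^-1.
  by have := sqr_ge0 (q - 2^-1); rewrite sqrrB; move: (q) => z; nra.
have W : ((e + e') / 2) ^+ 2 <= w ^+ 2.
  have w0 : 0 < w by exact: expR_gt0.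
  by rewrite ler_sqr ?nnegrE; [lra|lra|lra].
apply: le_trans W; rewrite sq.
apply: le_trans (_ : 1 + 4^-1 * (e - e') ^+ 2 <= _).
  by rewrite lerD2l ler_wpM2r ?sqr_ge0.
rewrite le_eqVlt; apply/orP; left; apply/eqP.
have -> : ((e + e') / 2) ^+ 2 = 4^-1 * (e - e') ^+ 2 + e * e' by field.
by rewrite E1 addrC.
Qed.

(** The one-sided bound suffices because [x] and [y] may be exchanged. All list lengths are covered,
    which makes the property stable under fixing the first entry. *)
Definition bounded_diff (c : R) (F : seq X -> R) :=
  forall s1 x y s2, F (s1 ++ x :: s2) - F (s1 ++ y :: s2) <= c.

(** Induction on the sample instead of martingale differences: given the first draw [x] the
    induction hypothesis applies, and the conditional mean as a function of [x] varies by at most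
    [c], so that [expR_bounded_diff] handles the remaining sum. *)
Lemma mcdiarmid_mgf n (lam c : R) F : 0 < c -> 0 < lam -> bounded_diff c F ->
  iid_mean n (fun s => expR (lam * F s)) <=
  expR (lam * iid_mean n F + n%:R * ((lam * c) ^+ 2 / 4)).
Proof.
move=> c0 lam0; elim: n F => [|n ih] F Fc /=; first by rewrite mul0r addr0.
set k := (lam * c) ^+ 2 / 4 in ih *.
have Fx x : bounded_diff c (fun s => F (x :: s)) by move=> s1; exact: (Fc (x :: s1)).
apply: le_trans (_ : \sum_x p x *
    (expR (lam * iid_mean n (fun s => F (x :: s))) * expR (n%:R * k)) <= _).
  by apply: ler_sum => x _; rewrite ler_wpM2l// -expRD; exact: ih.
under [leLHS]eq_bigr do rewrite mulrA.
rewrite -mulr_suml -natr1 mulrDl mul1r addrA [lam * _ + _]addrC -addrA.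
rewrite [X in _ <= X]expRD mulrC ler_pM2l ?expR_gt0//.
have := @expR_bounded_diff (fun x => lam * iid_mean n (fun s => F (x :: s))) (lam * c)
  (mulr_gt0 lam0 c0).
rewrite -/k; under [X in expR (X + _)]eq_bigr do rewrite mulrCA.
rewrite -mulr_sumr; apply => x y; rewrite -mulrBr ler_wpM2l ?(ltW lam0)//.
rewrite -[_ - _]addr0 -mulN1r -iid_meanZ -iid_meanD -[leRHS](iid_mean_cst n) addr0.
by apply: iid_mean_le => s _; rewrite mulN1r; exact: (Fc [::]).
Qed.

Lemma mcdiarmid n (c : R) F (t : R) : (0 < n)%N -> 0 < c -> 0 < t -> bounded_diff c F ->
  iid_mean n (fun s => (iid_mean n F + t <= F s)%R%:R) <= expR (- (t ^+ 2 / (n%:R * c ^+ 2))).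
Proof.
move=> n0 c0 t0 Fc; have n0' : 0 < n%:R :> R by rewrite ltr0n.
(* The minimizer of [- lam * t + n * (lam * c)^2 / 4], the exponent of the Chernoff bound. *)
pose lam := 2 * t / (n%:R * c ^+ 2).
have lam0 : 0 < lam by rewrite /lam divr_gt0 ?mulr_gt0 ?exprn_gt0.
apply: le_trans (_ : iid_mean n (fun s =>
    expR (- (lam * (iid_mean n F + t))) * expR (lam * F s)) <= _).
  apply: iid_mean_le => s _; rewrite -expRD [- _ + _]addrC -mulrBr.
  case: (leP (iid_mean n F + t) (F s)) => [h|_]; last exact: expR_ge0.
  by rewrite -(expR0 R) ler_expR mulr_ge0 ?(ltW lam0)// subr_ge0.
rewrite iid_meanZ; apply: le_trans (ler_wpM2l (expR_ge0 _) (mcdiarmid_mgf n c0 lam0 Fc)) _.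
rewrite -expRD ler_expR le_eqVlt; apply/orP; left; apply/eqP.
by rewrite /lam; field; rewrite !gt_eqF.
Qed.

End Concentration.

(** * Suprema and sign averages *)

Section SupOn.
Variables (R : realType) (T : Type) (C : set T).
Implicit Types u v g h : T -> R.

(** This real supremum is meaningful only for functions bounded on [C], hence the [bounded_on]
    conditions carried along below. *)
Definition SupOn u : R := sup (u @` C).

Definition bounded_on u := exists M, forall t, C t -> `|u t| <= M.

Lemma bounded_onD u v : bounded_on u -> bounded_on v -> bounded_on (u + v).
Proof.
move=> [M uM] [N vN]; exists (M + N) => t Ct.
by apply: le_trans (ler_normD _ _) _; apply: lerD; [exact: uM|exact: vN].
Qed.

Lemma bounded_onN u : bounded_on u -> bounded_on (- u).
Proof. by move=> [M uM]; exists M => t Ct; rewrite normrN; exact: uM. Qed.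

Lemma bounded_onB u v : bounded_on u -> bounded_on v -> bounded_on (u - v).
Proof. by move=> bu bv; apply: bounded_onD => //; exact: bounded_onN. Qed.

Lemma bounded_on0 : bounded_on 0.
Proof. by exists 0 => t _; rewrite normr0. Qed.

Lemma bounded_on_sum (I : Type) (r : seq I) (F : I -> T -> R) :
  (forall i, bounded_on (F i)) -> bounded_on (\sum_(i <- r) F i).
Proof.
move=> bF; elim: r => [|i r ih]; first by rewrite big_nil; exact: bounded_on0.
by rewrite big_cons; apply: bounded_onD.
Qed.

Lemma bounded_on_le u v (a : R) : 0 <= a -> bounded_on v ->
  (forall t, C t -> `|u t| <= a * `|v t|) -> bounded_on u.
Proof.
move=> a0 [M vM] uv; exists (a * M) => t Ct; apply: le_trans (uv t Ct) _.
by rewrite ler_wpM2l// vM.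
Qed.

Lemma SupOn_ub u t : bounded_on u -> C t -> u t <= SupOn u.
Proof.
move=> [M uM] Ct; apply: ub_le_sup; last by exists t.
by exists M => _ [t' Ct' <-]; exact: le_trans (ler_norm _) (uM _ Ct').
Qed.

Hypothesis C0 : C !=set0.

Lemma SupOn_le u M : (forall t, C t -> u t <= M) -> SupOn u <= M.
Proof.
move=> uM; apply: ge_sup => [|_ [t Ct <-]]; last exact: uM.
by case: C0 => t Ct; exists (u t), t.
Qed.

Lemma SupOn0 : SupOn 0 = 0.
Proof.
apply/eqP; rewrite eq_le SupOn_le//=; case: C0 => t Ct.
by apply: (@SupOn_ub 0 t) => //; exact: bounded_on0.
Qed.

Lemma SupOnD_le u v : bounded_on u -> bounded_on v ->
  SupOn (u + v) <= SupOn u + SupOn v.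
Proof. by move=> bu bv; apply: SupOn_le => t Ct; apply: lerD; exact: SupOn_ub. Qed.

(** The one-sign case of the contraction principle. For [t] in the first supremum and [t'] in the
    second, [g t - g t'] is at most [|h t - h t'|]; the sign of [h t - h t'] decides which of the
    two points is used with [+ h]. Only increments of [g] matter, so additive constants are free. *)
Lemma SupOn_contraction v g h : bounded_on v -> bounded_on h ->
  (forall t t', C t -> C t' -> `|g t - g t'| <= `|h t - h t'|) ->
  SupOn (v + g) + SupOn (v - g) <= SupOn (v + h) + SupOn (v - h).
Proof.
move=> bv bh gh; rewrite -lerBrDr; apply: SupOn_le => t Ct.
rewrite lerBrDr addrC -lerBrDr; apply: SupOn_le => t' Ct'.
rewrite lerBrDr.
have bp : bounded_on (v + h) by exact: bounded_onD.
have bm : bounded_on (v - h) by exact: bounded_onB.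
have /= := SupOn_ub bp Ct; have /= := SupOn_ub bm Ct.
have /= := SupOn_ub bp Ct'; have /= := SupOn_ub bm Ct'.
have := le_trans (ler_norm _) (gh _ _ Ct Ct').
rewrite !fctE.
by case: (ger0P (h t - h t')); lra.
Qed.

End SupOn.

(** * Sign averages and the contraction principle *)

Section RademacherAverage.
Variables (R : realType) (X : Type) (V : zmodType) (leaf : V -> R) (G : X -> V).

(* [rad_avg u xs] averages [leaf (u + \sum_i +/- G x_i)] over all choices of the signs. *)
Fixpoint rad_avg (u : V) (xs : seq X) : R :=
  if xs is x :: xs' then (rad_avg (u + G x) xs' + rad_avg (u - G x) xs') / 2 else leaf u.

End RademacherAverage.

Section Rademacher.
Variables (R : realType) (X : Type).

Section Generic.
Variable V : zmodType.
Implicit Types (leaf : V -> R) (G : X -> V) (u : V).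

Lemma rad_sum (I : Type) (r : seq I) (leaf : I -> V -> R) G u xs :
  rad_avg (fun v => \sum_(i <- r) leaf i v) G u xs = \sum_(i <- r) rad_avg (leaf i) G u xs.
Proof.
by elim: xs u => //= x xs ih u; rewrite !ih -big_split/= mulr_suml.
Qed.

Lemma radD leaf leaf' G u xs :
  rad_avg (fun v => leaf v + leaf' v) G u xs = rad_avg leaf G u xs + rad_avg leaf' G u xs.
Proof. by elim: xs u => //= x xs ih u; rewrite !ih; ring. Qed.

Lemma radZ a leaf G u xs : rad_avg (fun v => a * leaf v) G u xs = a * rad_avg leaf G u xs.
Proof. by elim: xs u => //= x xs ih u; rewrite !ih; ring. Qed.

Lemma rad_cst (c : R) G u xs : rad_avg (fun=> c) G u xs = c.
Proof. by elim: xs u => //= x xs ih u; rewrite !ih; lra. Qed.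

Lemma rad_shift leaf G w u xs :
  rad_avg (fun v => leaf (v + w)) G u xs = rad_avg leaf G (u + w) xs.
Proof. by elim: xs u => //= x xs ih u; rewrite !ih (addrAC u (G x)) (addrAC u (- G x)). Qed.

Lemma radN leaf G u xs : rad_avg leaf (fun x => - G x) u xs = rad_avg leaf G u xs.
Proof. by elim: xs u => //= x xs ih u; rewrite !ih opprK addrC. Qed.

(** The invariant [I] (boundedness, linearity) is needed because the inequalities between leaves
    hold only for sign sums that are actually reached. *)
Lemma rad_le (I : V -> Prop) leaf leaf' G u xs :
  (forall v, I v -> leaf v <= leaf' v) ->
  (forall v x, I v -> I (v + G x)) -> (forall v x, I v -> I (v - G x)) ->
  I u -> rad_avg leaf G u xs <= rad_avg leaf' G u xs.
Proof.
move=> le Ip Im; elim: xs u => [|x xs ih] u Iu /=; first exact: le.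
by rewrite ler_pM2r ?invr_gt0// lerD// ih//; [exact: Ip|exact: Im].
Qed.

End Generic.

Lemma rad_comp (V W : zmodType) (phi : V -> W) (leaf : W -> R) (G : X -> V) u xs :
  {morph phi : v w / v + w} -> {morph phi : v w / v - w} ->
  rad_avg (leaf \o phi) G u xs = rad_avg leaf (phi \o G) (phi u) xs.
Proof. by move=> pD pB; elim: xs u => //= x xs ih u; rewrite !ih pD pB. Qed.

Section OnSet.
Variables (T : Type) (C : set T).
Hypothesis C0 : C !=set0.
Implicit Types G H : X -> T -> R.

Local Notation radC := (rad_avg (SupOn C)).

Lemma rad_contraction G H u xs : bounded_on C u ->
  (forall x, bounded_on C (G x)) -> (forall x, bounded_on C (H x)) ->
  (forall x t t', C t -> C t' -> `|G x t - G x t'| <= `|H x t - H x t'|) ->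
  radC G u xs <= radC H u xs.
Proof.
move=> bu bG bH GH; elim: xs u bu => [|x xs ih] u bu //=.
rewrite ler_pM2r ?invr_gt0//.
apply: le_trans (lerD (ih _ (bounded_onD bu (bH x))) (ih _ (bounded_onB bu (bH x)))).
(* The first sign is moved into the leaf, behind all the other signs, where [SupOn_contraction]
   applies pointwise. *)
rewrite -!rad_shift -!radD.
apply: (rad_le (I := bounded_on C)) bu => [v bv|v y bv|v y bv].
- by apply: SupOn_contraction => //; exact: GH.
- exact: bounded_onD.
- exact: bounded_onB.
Qed.

Lemma rad_subadd G H u v xs : bounded_on C u -> bounded_on C v ->
  (forall x, bounded_on C (G x)) -> (forall x, bounded_on C (H x)) ->
  radC (fun x => G x + H x) (u + v) xs <= radC G u xs + radC H v xs.
Proof.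
move=> bu bv bG bH; elim: xs u v bu bv => [|x xs ih] u v bu bv /=.
  exact: SupOnD_le.
rewrite opprD (addrACA u v (G x)) (addrACA u v (- G x)) -mulrDl ler_pM2r ?invr_gt0// [leRHS]addrACA.
by apply: lerD; apply: ih => //; (apply: bounded_onD || apply: bounded_onB) => //;
  exact: bounded_onN.
Qed.

Lemma rad_le_scale (a : R) G u xs : 0 <= a -> bounded_on C u ->
  (forall x, bounded_on C (G x)) ->
  radC (fun x t => a * G x t) (fun t => a * u t) xs <= a * radC G u xs.
Proof.
move=> a0 bu bG; elim: xs u bu => [|x xs ih] u bu /=.
  by apply: SupOn_le => // t Ct; rewrite ler_wpM2l//; exact: SupOn_ub.
rewrite mulrA ler_pM2r ?invr_gt0// mulrDr.
have -> : (fun t => a * u t) + (fun t => a * G x t) = (fun t => a * (u + G x) t).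
  by apply/funext => t; rewrite !fctE mulrDr.
have -> : (fun t => a * u t) - (fun t => a * G x t) = (fun t => a * (u - G x) t).
  by apply/funext => t; rewrite !fctE mulrBr.
by apply: lerD; apply: ih => //; (apply: bounded_onD || apply: bounded_onB) => //;
  exact: bounded_onN.
Qed.

Lemma rad_sum_le (I : Type) (r : seq I) (G : I -> X -> T -> R) xs :
  (forall i x, bounded_on C (G i x)) ->
  radC (fun x => \sum_(i <- r) G i x) 0 xs <= \sum_(i <- r) radC (G i) 0 xs.
Proof.
move=> bG; elim: r => [|i r ih].
  rewrite big_nil (_ : (fun x => _) = fun=> 0); last by apply/funext => x; rewrite big_nil.
  rewrite (_ : radC _ _ _ = 0)//; elim: xs => [|x xs ih] /=; first exact: SupOn0.
  by rewrite subr0 addr0 ih addr0 mul0r.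
have -> : (fun x => \sum_(j <- i :: r) G j x) = (fun x => G i x + \sum_(j <- r) G j x).
  by apply/funext => x; rewrite big_cons.
have b0 := bounded_on0 R C.
have bs x : bounded_on C (\sum_(j <- r) G j x) by exact: bounded_on_sum.
have := rad_subadd xs b0 b0 (bG i) bs; rewrite addr0 big_cons => /le_trans; apply.
by rewrite lerD2l.
Qed.

(* [max f g = (f + g) / 2 + |f - g| / 2], and the contraction principle removes
   the absolute value. *)
Lemma rad_max_le G H xs :
  (forall x, bounded_on C (G x)) -> (forall x, bounded_on C (H x)) ->
  radC (fun x t => Num.max (G x t) (H x t)) 0 xs <= radC G 0 xs + radC H 0 xs.
Proof.
move=> bG bH.
pose hf F : X -> T -> R := fun x t => 2^-1 * F x t.
have bhf F : (forall x, bounded_on C (F x)) -> forall x, bounded_on C (hf F x).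
  move=> bF x; apply: (@bounded_on_le _ _ _ _ (F x) 1) => // t _.
  by rewrite normrM mul1r ler_piMl// ger0_norm// invf_le1// ler1n.
have b0 := bounded_on0 R C.
have half F : (forall x, bounded_on C (F x)) -> radC (hf F) 0 xs + radC (hf F) 0 xs <= radC F 0 xs.
  move=> bF; have := @rad_le_scale 2^-1 F 0 xs _ b0 bF.
  rewrite (_ : (fun t => _ * _) = 0); last by apply/funext => t; rewrite mulr0.
  by rewrite invr_ge0 => /(_ (ler0n _ 2)); rewrite -/(hf F); lra.
pose A x t : R := `|hf G x t - hf H x t|.
have bB x : bounded_on C (hf G x - hf H x) by apply: bounded_onB; exact: bhf.
have bA x : bounded_on C (A x).
  by apply: (@bounded_on_le _ _ _ _ (hf G x - hf H x) 1) => // t _; rewrite normr_id mul1r.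
have -> : (fun x t => Num.max (G x t) (H x t)) = (fun x => (hf G x + hf H x) + A x).
  apply/funext => x; apply/funext => t; rewrite !fctE /A /hf.
  by rewrite -mulrBr normrM gtr0_norm ?invr_gt0// maxr_absE; lra.
have bS x : bounded_on C (hf G x + hf H x) by apply: bounded_onD; exact: bhf.
have := rad_subadd xs b0 b0 bS bA; rewrite addr0.
have := rad_subadd xs b0 b0 (bhf _ bG) (bhf _ bH); rewrite addr0.
have -> : 0 = 0 - 0 :> (T -> R) by rewrite subr0.
have bN x : bounded_on C (- hf H x) by apply: bounded_onN; exact: bhf.
have := rad_subadd xs b0 b0 (bhf _ bG) bN; rewrite addr0 radN.
have : radC A 0 xs <= radC (fun x => hf G x - hf H x) 0 xs.
  apply: rad_contraction => // x t t' _ _; exact: ler_dist_dist.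
have := half _ bG; have := half _ bH; rewrite subr0; lra.
Qed.

End OnSet.

Lemma SupOn_image (T T' : Type) (C : set T) (C' : set T') (phi : T' -> T) (u : T -> R) :
  C' !=set0 -> (forall t, C' t -> C (phi t)) -> bounded_on C u ->
  SupOn C' (u \o phi) <= SupOn C u.
Proof. by move=> C0 CC bu; apply: SupOn_le => // t Ct; exact: (SupOn_ub bu (CC t Ct)). Qed.

(** Passes from parameters to functions: a supremum over families is at most the supremum over a
    ball that contains their networks. *)
Lemma rad_image (T T' : Type) (C : set T) (C' : set T') (phi : T' -> T)
    (G : X -> T -> R) (u : T -> R) xs :
  C' !=set0 -> (forall t, C' t -> C (phi t)) -> bounded_on C u ->
  (forall x, bounded_on C (G x)) ->
  rad_avg (SupOn C') (fun x => G x \o phi) (u \o phi) xs <= rad_avg (SupOn C) G u xs.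
Proof.
move=> C0 CC bu bG; elim: xs u bu => [|x xs ih] u bu /=; first exact: SupOn_image.
rewrite ler_pM2r ?invr_gt0//; apply: lerD; apply: ih.
  exact: bounded_onD.
exact: bounded_onB.
Qed.

End Rademacher.

(** * Symmetrization and uniform deviations *)

Section Symmetrization.
Variables (R : realType) (X : finType) (p : X -> R).
Hypothesis p_ge0 : forall x, 0 <= p x.
Hypothesis p_sum : \sum_x p x = 1.
Variables (T : Type) (C : set T).
Hypothesis C0 : C !=set0.
Variable l : X -> T -> R.
Hypothesis bl : forall x, bounded_on C (l x).

Let mean : T -> R := fun t => \sum_x p x * l x t.
Let twice : X -> T -> R := fun x t => 2 * l x t.

Let btwice x : bounded_on C (twice x).
Proof.
apply: (@bounded_on_le _ _ _ _ (l x) 2) => // t _; by rewrite normrM ger0_norm.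
Qed.

(** The mean is an average over a ghost draw [y], and a supremum of averages is at most the average
    of the suprema. Then [v + l y - l x] is half of [v + 2 l y] plus half of [v - 2 l x]; splitting
    the supremum accordingly separates [x] from [y], so the sign appears without exchanging the two
    draws. This is why [twice] carries the factor 2. *)
Lemma symmetrization_step v : bounded_on C v ->
  \sum_x p x * SupOn C (v + (mean - l x)) <=
  \sum_x p x * ((SupOn C (v + twice x) + SupOn C (v - twice x)) / 2).
Proof.
move=> bv.
pose B x y := (SupOn C (v + twice y) + SupOn C (v - twice x)) / 2.
have H x : SupOn C (v + (mean - l x)) <= \sum_y p y * B x y.
  apply: SupOn_le => // t Ct; rewrite !fctE /mean.
  have -> : v t + (\sum_y p y * l y t - l x t) = \sum_y p y * (v t + (l y t - l x t)).
    have E (c : R) : c = \sum_y p y * c by rewrite -mulr_suml p_sum mul1r.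
    rewrite {1}(E (v t)) {1}(E (l x t)) -sumrB -big_split/=.
    by apply: eq_bigr => y _; ring.
  apply: ler_sum => y _; rewrite ler_wpM2l// /B.
  have := SupOn_ub (bounded_onD bv (btwice y)) Ct.
  have := SupOn_ub (bounded_onB bv (btwice x)) Ct.
  by rewrite !fctE /twice; lra.
apply: le_trans (_ : \sum_x p x * \sum_y p y * B x y <= _).
  by apply: ler_sum => x _; rewrite ler_wpM2l.
rewrite le_eqVlt; apply/orP; left; apply/eqP.
pose a x := SupOn C (v + twice x); pose b x := SupOn C (v - twice x).
have E x : \sum_y p y * B x y = (\sum_y p y * a y + b x) / 2.
  have -> : b x = \sum_y p y * b x by rewrite -mulr_suml p_sum mul1r.
  rewrite -big_split/= mulr_suml.
  by apply: eq_bigr => y _; rewrite /B /a /b; ring.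
under eq_bigr do rewrite E mulrA mulrDr.
rewrite -mulr_suml big_split/= -mulr_suml p_sum mul1r -big_split/= mulr_suml.
by apply: eq_bigr => x _; rewrite /a /b; ring.
Qed.

(** Draws are symmetrized one at a time: the tail by induction, then the first draw inside the leaf,
    after interchanging its sum with the means and sign averages of the tail. *)
Lemma symmetrization n u : bounded_on C u ->
  iid_mean p n (fun s => SupOn C (u + \sum_(x <- s) (mean - l x))) <=
  iid_mean p n (rad_avg (SupOn C) twice u).
Proof.
have bmean : bounded_on C mean.
  have -> : mean = \sum_x (fun t => p x * l x t) by apply/funext => t; rewrite fct_sumE.
  apply: bounded_on_sum => x; apply: (@bounded_on_le _ _ _ _ (l x) (p x)) => // t _.
  by rewrite normrM ger0_norm.
have bd x : bounded_on C (mean - l x) by exact: bounded_onB.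
elim: n u => [|n ih] u bu /=; first by rewrite big_nil addr0.
apply: le_trans (_ : \sum_x p x * iid_mean p n (rad_avg (SupOn C) twice (u + (mean - l x))) <= _).
  apply: ler_sum => x _; rewrite ler_wpM2l//.
  apply: le_trans (ih _ (bounded_onD bu (bd x))).
  by apply: iid_mean_le => // s _; rewrite big_cons addrA.
under [leLHS]eq_bigr do rewrite -iid_meanZ.
under [leRHS]eq_bigr do rewrite -iid_meanZ.
rewrite -!iid_mean_sum; apply: iid_mean_le => // s _.
under [leLHS]eq_bigr do rewrite -rad_shift -radZ.
have E x : p x * ((rad_avg (SupOn C) twice (u + twice x) s +
                     rad_avg (SupOn C) twice (u - twice x) s) / 2)
    = rad_avg (fun v => p x * (2^-1 * (SupOn C (v + twice x) + SupOn C (v - twice x)))) twice u s.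
  by rewrite radZ radZ radD !rad_shift; ring.
under [leRHS]eq_bigr do rewrite E.
rewrite -!rad_sum.
apply: (rad_le (I := bounded_on C)) bu => [v bv|v y bv|v y bv].
- apply: le_trans (symmetrization_step bv) _.
  by apply: ler_sum => x _; rewrite le_eqVlt; apply/orP; left; apply/eqP; ring.
- exact: bounded_onD.
- exact: bounded_onB.
Qed.

(** The supremum of the centred sum has differences bounded by [c], since the loss lies in an
    interval of length [c], and mean at most [rho] by symmetrization. The event is contained in a
    deviation of this supremum by [tau]. *)
Lemma uniform_deviation n (c rho tau : R) : (0 < n)%N -> 0 < c -> 0 < tau ->
  (forall x t, C t -> 0 <= l x t <= c) ->
  (forall s, size s = n -> rad_avg (SupOn C) twice 0 s <= rho) ->
  iid_mean p n (fun s => `[< exists2 t, C t &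
      rho + tau <= \sum_(x <- s) (mean t - l x t) >]%:R) <=
  expR (- (tau ^+ 2 / (n%:R * c ^+ 2))).
Proof.
move=> n0 c0 tau0 lc Hrho.
pose F s := SupOn C (\sum_(x <- s) (mean - l x)).
have bsum s : bounded_on C (\sum_(x <- s) (mean - l x)).
  apply: bounded_on_sum => x; apply: bounded_onB => //.
  have -> : mean = \sum_x (fun t => p x * l x t) by apply/funext => t; rewrite fct_sumE.
  apply: bounded_on_sum => y; apply: (@bounded_on_le _ _ _ _ (l y) (p y)) => // t _.
  by rewrite normrM ger0_norm.
have F_ub s t : C t -> \sum_(x <- s) (mean t - l x t) <= F s.
  move=> Ct; have -> : \sum_(x <- s) (mean t - l x t) = (\sum_(x <- s) (mean - l x)) t.
    by rewrite fct_sumE.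
  exact: SupOn_ub.
have EF : iid_mean p n F <= rho.
  rewrite -(iid_mean_cst p_sum n rho); apply: le_trans (iid_mean_le p_ge0 Hrho).
  have := @symmetrization n 0 (bounded_on0 _ _); congr (iid_mean _ _ _ <= _).
  by apply/funext => s; rewrite add0r.
have Fc : bounded_diff c F.
  move=> s1 x y s2; rewrite lerBlDr; apply: SupOn_le => // t Ct.
  have := F_ub (s1 ++ y :: s2) t Ct.
  rewrite fct_sumE !big_cat !big_cons /= => Hy.
  rewrite -lerBlDl; apply: le_trans Hy.
  have E s : \sum_(i <- s) (mean - l i) t = \sum_(i <- s) (mean t - l i t) by [].
  rewrite !E -[(mean - l x) t]/(mean t - l x t).
  by have /andP[? ?] := lc x t Ct; have /andP[? ?] := lc y t Ct; lra.
apply: le_trans (mcdiarmid p_ge0 p_sum n0 c0 tau0 Fc).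
apply: iid_mean_le => // s sn; rewrite ler_nat.
case: asboolP => // -[t Ct ht].
rewrite (_ : (_ <= F s) = true)//.
apply: le_trans (_ : rho + tau <= _); first by rewrite lerD2r.
exact: le_trans ht (F_ub s t Ct).
Qed.

End Symmetrization.

(** * The gauge of residual networks *)

Section Relu.
Variable R : realType.
Implicit Types z w : R.

Lemma reluM (a z : R) : 0 <= a -> relu (a * z) = a * relu z.
Proof. by move=> a0; rewrite /relu maxr_pMr// mulr0. Qed.

Lemma relu_lip z w : `|relu z - relu w| <= `|z - w|.
Proof.
rewrite /relu !maxr_absE !subr0 !addr0 -mulrBl normrM [`|2^-1|]gtr0_norm ?invr_gt0//.
rewrite ler_pdivrMr// opprD addrACA; apply: le_trans (ler_normD _ _) _.
by rewrite mulr_natr mulr2n lerD2l; exact: ler_dist_dist.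
Qed.

Lemma relu_norm_le z : `|relu z| <= `|z|.
Proof. by have := relu_lip z 0; rewrite /relu maxxx !subr0. Qed.

End Relu.

Section Gauge.
Variables (R : realType) (d : nat).
Hypothesis d0 : (0 < d)%N.
Local Notation func := ('cV[R]_d -> R).
Implicit Types (f g : func) (L : func -> R) (q b : R).

Definition linear_form L :=
  forall a f g, L (fun x => a * f x + g x) = a * L f + L g.

Definition coordf (j : 'I_d) : func := fun x => x j 0.

(* [gauge l f q] says that [f] belongs to [q] times the l-th unit ball, where the
   0-th ball is the absolutely convex hull of the coordinates and the (l+1)-st one
   that of the coordinates and of the functions [relu \o g / 3], [g] in the l-th
   ball.  The hull is described by duality, which makes stability under linear
   combinations and the bound of any linear form immediate. *)
Fixpoint gauge (l : nat) f q : Prop :=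
  forall L b, linear_form L -> (forall j, `|L (coordf j)| <= b) ->
  (if l is l'.+1 then forall g, gauge l' g 1 -> `|L (@relu R \o g)| <= 3 * b else True) ->
  `|L f| <= q * b.

Lemma linear_formD L f g : linear_form L -> L (fun x => f x + g x) = L f + L g.
Proof.
move=> lL; rewrite -[L f]mul1r -lL; congr L; by apply/funext => x; rewrite mul1r.
Qed.

Lemma linear_form0 L : linear_form L -> L (fun=> 0) = 0.
Proof.
move=> /linear_formD - /(_ (fun=> 0) (fun=> 0)) /eqP.
have -> : (fun x : 'cV[R]_d => 0 + 0 : R) = fun=> 0 by apply/funext => x; rewrite addr0.
by rewrite -subr_eq subrr eq_sym => /eqP.
Qed.

Lemma linear_formZ L a f : linear_form L -> L (fun x => a * f x) = a * L f.
Proof.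
move=> lL; rewrite -[RHS]addr0 -(linear_form0 lL) -lL; congr L.
by apply/funext => x; rewrite addr0.
Qed.

Lemma linear_form_eval x : linear_form (fun f => f x).
Proof. by []. Qed.

Lemma coord_bound_ge0 L b : (forall j, `|L (coordf j)| <= b) -> 0 <= b.
Proof. by move=> /(_ (Ordinal d0)); exact: le_trans. Qed.

Lemma gauge_intro l f q :
  (forall L b, linear_form L -> (forall j, `|L (coordf j)| <= b) ->
    (if l is l'.+1 then forall g, gauge l' g 1 -> `|L (@relu R \o g)| <= 3 * b else True) ->
    `|L f| <= q * b) -> gauge l f q.
Proof. by case: l. Qed.

Lemma gauge_elim l f q L b : gauge l f q ->
  linear_form L -> (forall j, `|L (coordf j)| <= b) ->
  (if l is l'.+1 then forall g, gauge l' g 1 -> `|L (@relu R \o g)| <= 3 * b else True) ->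
  `|L f| <= q * b.
Proof. by case: l => [|l] /= h; exact: h. Qed.

Lemma gaugeD l f g q r : gauge l f q -> gauge l g r ->
  gauge l (fun x => f x + g x) (q + r).
Proof.
move=> fq gr; apply: gauge_intro => L b lL Lb Ll.
rewrite linear_formD// mulrDl; apply: le_trans (ler_normD _ _) _.
by apply: lerD; [exact: gauge_elim fq _ _ _|exact: gauge_elim gr _ _ _].
Qed.

Lemma gaugeZ l f q a : gauge l f q -> gauge l (fun x => a * f x) (`|a| * q).
Proof.
move=> fq; apply: gauge_intro => L b lL Lb Ll.
by rewrite linear_formZ// normrM -mulrA ler_wpM2l//; exact: gauge_elim fq _ _ _.
Qed.

Lemma gauge0 l : gauge l (fun=> 0) 0.
Proof. by apply: gauge_intro => L b lL _ _; rewrite linear_form0// normr0 mul0r. Qed.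

Lemma gauge_le l f q r : q <= r -> gauge l f q -> gauge l f r.
Proof.
move=> qr fq; apply: gauge_intro => L b lL Lb Ll.
apply: le_trans (gauge_elim fq lL Lb Ll) _.
by rewrite ler_wpM2r// (coord_bound_ge0 Lb).
Qed.

Lemma gauge_sum l (I : Type) (r : seq I) (F : I -> func) (Q : I -> R) :
  (forall i, gauge l (F i) (Q i)) ->
  gauge l (fun x => \sum_(i <- r) F i x) (\sum_(i <- r) Q i).
Proof.
move=> FQ; elim: r => [|i r ih].
  rewrite big_nil (_ : (fun x => _) = fun=> 0); first exact: gauge0.
  by apply/funext => x; rewrite big_nil.
rewrite big_cons (_ : (fun x => _) = fun x => F i x + \sum_(j <- r) F j x).
  exact: gaugeD.
by apply/funext => x; rewrite big_cons.
Qed.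

Lemma gauge_coord l j : gauge l (coordf j) 1.
Proof. by apply: gauge_intro => L b _ Lb _; rewrite mul1r. Qed.

Lemma gaugeS l f q : gauge l f q -> gauge l.+1 f q.
Proof.
elim: l f q => [|l ih] f q fq; apply: gauge_intro => L b lL Lb Ll.
  by apply: gauge_elim fq _ _ _.
by apply: gauge_elim fq lL Lb _ => g /ih; exact: Ll.
Qed.

(** Positive homogeneity of ReLU reduces to the unit ball, where the factor 3 is built in. Division
    by [q] fails for [q = 0]; there [g] has every small positive gauge, and [e] tends to 0. *)
Lemma gauge_relu l g q : 0 <= q -> gauge l g q -> gauge l.+1 (@relu R \o g) (3 * q).
Proof.
move=> q0 gq; apply: gauge_intro => L b lL Lb Ll.
have b0 := coord_bound_ge0 Lb.
have pos (r : R) : 0 < r -> gauge l g r -> `|L (@relu R \o g)| <= 3 * r * b.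
  move=> r0 gr; have : gauge l (fun x => r^-1 * g x) 1.
    have -> : 1 = `|r^-1| * r by rewrite normfV gtr0_norm// mulVf// gt_eqF.
    exact: gaugeZ.
  move=> /Ll; rewrite (_ : _ \o _ = fun x => r^-1 * relu (g x)); last first.
    by apply/funext => x /=; rewrite reluM// invr_ge0 ltW.
  rewrite (linear_formZ _ (@relu R \o g))// normrM normfV (gtr0_norm r0).
  by rewrite ler_pdivrMl// mulrCA mulrA.
move: q0; rewrite le_eqVlt => /predU1P[q0|]; last by move=> q1; exact: pos.
apply/ler_addgt0Pr => e e0; rewrite -q0 mulr0 mul0r add0r.
have k0 : 0 < e / (3 * (b + 1)) by rewrite divr_gt0// mulr_gt0// ltr_wpDl.
apply: le_trans (pos _ k0 _) _; first by apply: gauge_le gq; rewrite -q0 ltW.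
have b1 : 0 < b + 1 by rewrite ltr_wpDl.
have -> : 3 * (e / (3 * (b + 1))) * b = e * (b / (b + 1)) by field; rewrite gt_eqF.
by rewrite ler_piMr ?(ltW e0)// ler_pdivrMr// mul1r lerDl.
Qed.

(** Evaluation at [x] is an admissible form with [b = 1]. In the same way [gauge_at0] uses
    evaluation at the origin with [b = 0], and [gauge_lip] the difference of two evaluations. *)
Lemma gauge_bound l f q (x : 'cV[R]_d) : (forall j, `|x j 0| <= 1) -> gauge l f q -> `|f x| <= q.
Proof.
move=> x1; elim: l f q => [|l ih] f q fq; rewrite -[q]mulr1.
  exact: (gauge_elim fq (linear_form_eval x)).
apply: (gauge_elim fq (linear_form_eval x)) => // g /ih gx.
by rewrite mulr1 /=; apply: le_trans (relu_norm_le _) _; apply: le_trans gx _; rewrite ler1n.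
Qed.

Lemma gauge_at0 l f q : gauge l f q -> f 0 = 0.
Proof.
elim: l f q => [|l ih] f q fq; apply/eqP; rewrite -normr_le0 -(mulr0 q).
  by apply: (gauge_elim fq (linear_form_eval 0)) => // j; rewrite /coordf mxE normr0.
apply: (gauge_elim fq (linear_form_eval 0)) => [j|g /ih g0].
  by rewrite /coordf mxE normr0.
by rewrite /= g0 /relu maxxx normr0 mulr0.
Qed.

Lemma gauge_lip l f q (x y : 'cV[R]_d) b : (forall j, `|x j 0 - y j 0| <= b) -> gauge l f q ->
  `|f x - f y| <= q * b.
Proof.
move=> xb; have lL : linear_form (fun f => f x - f y) by move=> a g h /=; ring.
have b0 : 0 <= b by apply: le_trans (xb (Ordinal d0)).
elim: l f q => [|l ih] f q fq; first exact: (gauge_elim fq lL).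
apply: (gauge_elim fq lL) => // g /ih gx.
apply: le_trans (relu_lip _ _) _; apply: le_trans gx _.
by rewrite ler_wpM2r// ler1n.
Qed.

Section Network.
Variables (m D N : nat).

Let layer_norm (th : resnet_param R d m D N) l : 'M[R]_D :=
  1%:M + 3%:R *: (mabs (par_U th l) *m mabs (par_W th l)).

(** [w] collects gauge bounds of the components of [h]; its nonnegativity is propagated because
    [gauge_relu] requires it. The 3 in [layer_norm] is the one paid by [gauge_relu]. *)
Lemma gauge_layer (th : resnet_param R d m D N) l k (h : 'cV[R]_d -> 'cV[R]_D) (w : 'cV[R]_D) :
  (forall i, gauge k (fun x => h x i 0) (w i 0) /\ 0 <= w i 0) ->
  forall i, gauge k.+1 (fun x => (h x + par_U th l *m map_mx (@relu R) (par_W th l *m h x)) i 0)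
      ((layer_norm th l *m w) i 0) /\ 0 <= (layer_norm th l *m w) i 0.
Proof.
move=> hw i; set U := par_U th l; set W := par_W th l.
pose z a : R := \sum_j `|W a j| * w j 0.
have z0 a : 0 <= z a by apply: sumr_ge0 => j _; rewrite mulr_ge0//; case: (hw j).
have gz a : gauge k (fun x => (W *m h x) a 0) (z a).
  rewrite (_ : (fun x => _) = fun x => \sum_j W a j * h x j 0); last first.
    by apply/funext => x; rewrite mxE.
  by apply: gauge_sum => j; apply: gaugeZ; case: (hw j).
have -> : (layer_norm th l *m w) i 0 = w i 0 + \sum_a `|U i a| * (3 * z a).
  rewrite /layer_norm mulmxDl mul1mx mxE -scalemxAl mxE -mulmxA mxE mulr_sumr.
  congr (_ + _); apply: eq_bigr => a _; rewrite !mxE mulrCA; congr (_ * (_ * _)).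
  by apply: eq_bigr => j _; rewrite mxE.
split; last first.
  apply: addr_ge0; first by case: (hw i).
  by apply: sumr_ge0 => a _; rewrite !mulr_ge0.
rewrite (_ : (fun x => _) = fun x => h x i 0 +
  \sum_a U i a * relu ((W *m h x) a 0)); last first.
  by apply/funext => x; rewrite !mxE; congr (_ + _); apply: eq_bigr => a _; rewrite mxE.
apply: gaugeD; first by apply: gaugeS; case: (hw i).
by apply: gauge_sum => a; apply: gaugeZ; exact: (gauge_relu (z0 a) (gz a)).
Qed.

Lemma gauge_layers (th : resnet_param R d m D N) s k (h : 'cV[R]_d -> 'cV[R]_D) (w : 'cV[R]_D) :
  (forall i, gauge k (fun x => h x i 0) (w i 0) /\ 0 <= w i 0) ->
  forall i, gauge (size s + k) (fun x =>
      (foldl (fun h l => h + par_U th l *m map_mx (@relu R) (par_W th l *m h)) (h x) s) i 0)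
      ((foldl (fun w l => layer_norm th l *m w) w s) i 0) /\
    0 <= (foldl (fun w l => layer_norm th l *m w) w s) i 0.
Proof.
elim: s k h w => [|l s ih] k h w hw i; first exact: hw.
rewrite [size _]/= addSnnS; exact: (ih k.+1 _ _ (gauge_layer th l hw)).
Qed.

(** The path norm multiplies a row vector from the last layer backwards, whereas gauge bounds
    propagate as a column vector from the first layer on. *)
Lemma foldl_mulmx_rev (T : Type) (A : T -> 'M[R]_D) s (v : 'rV[R]_D) (c : 'cV[R]_D) :
  foldl (fun v l => v *m A l) v (rev s) *m c = v *m foldl (fun c l => A l *m c) c s.
Proof.
elim: s c => //= l s ih c.
by rewrite rev_cons foldl_rcons -mulmxA ih.
Qed.

Lemma gauge_resnet (th : resnet_param R d m D N) : gauge N (resnet th) (path_norm th).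
Proof.
pose w0 : 'cV[R]_D := mabs (par_V th) *m const_mx 1.
have w0E i : w0 i 0 = \sum_j `|par_V th i j| * 1.
  by rewrite mxE; apply: eq_bigr => j _; rewrite !mxE.
have base i : gauge 0 (fun x => (par_V th *m x) i 0) (w0 i 0) /\ 0 <= w0 i 0.
  rewrite w0E; split; last by apply: sumr_ge0 => j _; rewrite mulr1.
  rewrite (_ : (fun x => _) = fun x => \sum_j par_V th i j * coordf j x); last first.
    by apply/funext => x; rewrite mxE.
  by apply: gauge_sum => j; apply: gaugeZ; exact: gauge_coord.
have := gauge_layers th (enum 'I_N) base; rewrite addn0 size_enum_ord.
set wN := foldl _ w0 _ => hid.
apply: (@gauge_le _ _ (\sum_i `|par_u th i 0| * wN i 0)).
  rewrite /path_norm; set v := foldl _ _ _.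
  apply: le_trans (_ : \sum_j (v *m mabs (par_V th)) 0 j <= _); last first.
    by apply: ler_sum => j _; exact: ler_norm.
  have -> : \sum_j (v *m mabs (par_V th)) 0 j = (v *m w0) 0 0.
    by rewrite /w0 mulmxA [RHS]mxE; apply: eq_bigr => j _; rewrite [const_mx _ _ _]mxE mulr1.
  rewrite /v foldl_mulmx_rev -/wN mxE le_eqVlt; apply/orP; left; apply/eqP.
  by apply: eq_bigr => i _; rewrite !mxE.
rewrite (_ : resnet th = fun x => \sum_i par_u th i 0 * resnet_hidden th x i 0); last first.
  by apply/funext => x; rewrite /resnet mxE; apply: eq_bigr => i _; rewrite mxE.
by apply: gauge_sum => i; apply: gaugeZ; case: (hid i).
Qed.

Lemma path_norm_ge0 (th : resnet_param R d m D N) : 0 <= path_norm th.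
Proof. by apply: sumr_ge0. Qed.

End Network.

(** * Sign averages over the balls of the gauge *)

Section RademacherGauge.
Variables (X : Type) (pt : X -> 'cV[R]_d).
Hypothesis pt1 : forall x j, `|pt x j 0| <= 1.

(** The signed sums live in the space of functionals, so that each of them is itself a linear form
    to which [gauge_elim] applies. *)
Let ev x : func -> R := fun f => f (pt x).

(** Each sign contributes a factor [cosh (c * x_j)], at most [expR (c ^+ 2 / 2)] because coordinates
    are bounded by 1. *)
Lemma rad_expR (c : R) (j : 'I_d) (u : func -> R) xs :
  rad_avg (fun L : func -> R => expR (c * L (coordf j))) ev u xs <=
  expR (c * u (coordf j) + (size xs)%:R * (c ^+ 2 / 2)).
Proof.
elim: xs u => [|x xs ih] u /=; first by rewrite mul0r addr0.
rewrite ler_pdivrMr//; apply: le_trans (lerD (ih _) (ih _)) _.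
rewrite !fctE; set g := ev x (coordf j).
have -> : c * (u (coordf j) + g) + (size xs)%:R * (c ^+ 2 / 2) =
  (c * u (coordf j) + (size xs)%:R * (c ^+ 2 / 2)) + c * g by ring.
have -> : c * (u (coordf j) - g) + (size xs)%:R * (c ^+ 2 / 2) =
  (c * u (coordf j) + (size xs)%:R * (c ^+ 2 / 2)) - c * g by ring.
rewrite -[(size xs).+1%:R]natr1 mulrDl mul1r addrA.
set B := c * u (coordf j) + _; rewrite !(expRD B) -mulrDr -mulrA ler_pM2l ?expR_gt0//.
apply: le_trans (expRDexpRN_le _) _; rewrite mulrC ler_pM2r// ler_expR ler_pM2r ?invr_gt0//.
rewrite exprMn ler_piMr ?sqr_ge0// -real_normK ?num_real// expr_le1//; exact: pt1.
Qed.

Let maxcoord (L : func -> R) : R := \big[Num.max/0]_j `|L (coordf j)|.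

Lemma ln2d_gt0 : 0 < ln (2 * d%:R) :> R.
Proof.
rewrite ln_gt0// -(natrM R 2) ltr1n; move: d0; case: (d) => // k _.
by rewrite mulnS.
Qed.

(* Massart's finite class argument, with [e^y >= 1 + y] in place of Jensen. *)
Lemma rad_maxcoord xs :
  rad_avg maxcoord ev 0 xs <= Num.sqrt (2 * (size xs)%:R * ln (2 * d%:R)).
Proof.
set n := size xs; set a := ln (2 * d%:R).
have a0 : 0 < a := ln2d_gt0.
have [n0|n0] := posnP n.
  rewrite n0; have -> : xs = [::] by apply/nilP; rewrite /nilp -/n n0.
  by rewrite /= mulr0 mul0r sqrtr0; apply: bigmax_le => // j _; rewrite normr0.
have n0' : 0 < n%:R :> R by rewrite ltr0n.
set S := Num.sqrt _.
have S0 : 0 < S by rewrite sqrtr_gt0 !mulr_gt0.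
have S2 : S ^+ 2 = 2 * n%:R * a by rewrite sqr_sqrtr// ltW// !mulr_gt0.
pose lam := S / n%:R.
have lam0 : 0 < lam by rewrite divr_gt0.
(* From [1 + z <= expR z] at [z = lam * y - 2 * a] one gets [y <= k * expR (lam * y) + c0]. The
   point [2 * a] is chosen because [lam] satisfies [n * lam^2 / 2 = a], so [E] averages to at most
   [expR (2 * a)] and the bound becomes [2 * a / lam = S]. *)
pose k := lam^-1 * expR (- (2 * a)).
pose c0 := lam^-1 * (2 * a - 1).
have k0 : 0 <= k by rewrite mulr_ge0 ?expR_ge0// invr_ge0 ltW.
pose E (L : func -> R) := \sum_j (expR (lam * L (coordf j)) + expR (- lam * L (coordf j))).
apply: le_trans (_ : rad_avg (fun L : func -> R => k * E L + c0) ev 0 xs <= _).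
  apply: (@rad_le _ _ _ (fun=> True)) => // L _.
  have [j0 ->] : exists j, maxcoord L = `|L (coordf j)|.
    have [j _ Ej] := @eq_bigmax _ _ _ 0 (Ordinal d0) xpredT (fun j => `|L (coordf j)|)
      isT (fun _ _ => normr_ge0 _).
    by exists j; exact: Ej.
  set y := `|_|.
  have Ey : expR (lam * y) <= E L.
    rewrite /E (bigD1 j0)//= -[leLHS]addr0 lerD//; last first.
      by apply: sumr_ge0 => i _; rewrite addr_ge0// expR_ge0.
    rewrite /y; case: (ger0P (L (coordf j0))) => _; first by rewrite lerDl expR_ge0.
    by rewrite mulrN -mulNr lerDr expR_ge0.
  apply: le_trans (_ : k * expR (lam * y) + c0 <= _); last by rewrite lerD2r ler_wpM2l.
  rewrite /k /c0 -mulrA -expRD -mulrDr -ler_pdivrMl ?invr_gt0// invrK.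
  have := expR_ge1Dx (- (2 * a) + lam * y); lra.
have lam2 : n%:R * (lam ^+ 2 / 2) = a.
  by rewrite /lam expr_div_n S2; field; rewrite gt_eqF.
rewrite radD rad_cst radZ rad_sum.
apply: le_trans (_ : k * (\sum_(j < d) (2 * expR a)) + c0 <= _).
  rewrite lerD2r ler_wpM2l//; apply: ler_sum => j _; rewrite radD.
  have := rad_expR lam j 0 xs; have := rad_expR (- lam) j 0 xs.
  by rewrite sqrrN -/n lam2 !mulr0 !add0r; lra.
have -> : \sum_(j < d) (2 * expR a) = expR (2 * a).
  have e2 : expR a = 2 * d%:R by rewrite /a lnK// posrE mulr_gt0// ltr0n.
  have -> : 2 * a = a + a by ring.
  rewrite expRD sumr_const card_ord {2}e2 -[LHS]mulr_natr; ring.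
rewrite /k -mulrA -expRD addNr expR0 mulr1 /c0 mulrBr mulr1 addrC subrK.
have -> : lam^-1 * (2 * a) = (2 * n%:R * a) / S by rewrite /lam invf_div; ring.
by rewrite -S2 expr2 mulfK// gt_eqF.
Qed.

Let ball l : set func := [set f | gauge l f 1].
(** The invariant of the sign sums: linearity for [gauge_elim], boundedness on every ball for the
    suprema. *)
Let good_form L :=
  linear_form L /\ forall l, bounded_on (ball l) (fun g => L (@relu R \o g)).

Let ball0 l q : 0 <= q -> [set f : func | gauge l f q] !=set0.
Proof. by move=> q0; exists (fun=> 0); apply: gauge_le q0 (gauge0 _). Qed.

Let good_form0 : good_form 0.
Proof.
split=> [a f g|l]; first by rewrite [RHS](_ : _ = a * 0 + 0 :> R)// mulr0 addr0.
by exists 0 => g _; rewrite normr0.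
Qed.

Let good_formD L x : good_form L -> good_form (L + ev x).
Proof.
move=> [lL bL]; split=> [a f g|l]; first by rewrite !fctE lL /ev; ring.
apply: (bounded_onD (bL l)); exists 1 => g gl.
exact: le_trans (relu_norm_le _) (gauge_bound (pt1 x) gl).
Qed.

Let good_formB L x : good_form L -> good_form (L - ev x).
Proof.
move=> [lL bL]; split=> [a f g|l]; first by rewrite !fctE lL /ev; ring.
apply: (bounded_onB (bL l)); exists 1 => g gl.
exact: le_trans (relu_norm_le _) (gauge_bound (pt1 x) gl).
Qed.

(** An upper bound for the dual norm of the [l]-th ball. The supremum of [|L (relu \o g)|] is
    replaced by the sum of two one-sided suprema, to which contraction and sign symmetry apply; this
    doubling is the source of the factor 2/3. *)
Let gauge_dual l L : R :=
  if l is l'.+1 then maxcoord L + 3^-1 *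
    (SupOn (ball l') (fun g => L (@relu R \o g)) +
     SupOn (ball l') (fun g => - L (@relu R \o g)))
  else maxcoord L.

Let SupOn_gauge_dual l q L : 0 <= q -> good_form L ->
  SupOn [set f | gauge l f q] L <= q * gauge_dual l L.
Proof.
move=> q0 [lL bL]; apply: SupOn_le => [|f fq]; first exact: ball0.
have mc j : `|L (coordf j)| <= maxcoord L by exact: le_bigmax.
apply: le_trans (ler_norm _) _; case: l fq => [|l] fq; first exact: (gauge_elim fq lL mc).
have z0 : @relu R \o (fun=> 0) = (fun=> 0) :> func.
  by apply/funext => x /=; rewrite /relu maxxx.
have b0 : ball l (fun=> 0) by apply: gauge_le (gauge0 _).
have bN := bounded_onN (bL l).
(* The zero function lies in the ball, so both one-sided suprema are nonnegative and each is at most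
   their sum. *)
have L0 : L (@relu R \o (fun=> 0)) = 0 by rewrite z0 linear_form0.
have s1 := SupOn_ub (bL l) b0; rewrite L0 in s1.
have s2 : - L (@relu R \o (fun=> 0)) <= _ := SupOn_ub bN b0; rewrite L0 oppr0 in s2.
apply: (gauge_elim fq lL) => [j|g gl] /=.
  apply: le_trans (mc j) _; rewrite lerDl mulr_ge0// ?invr_ge0//.
  by apply: addr_ge0.
have m0 : 0 <= maxcoord L by apply: le_trans (mc (Ordinal d0)).
have := SupOn_ub (bL l) gl; have := SupOn_ub bN gl.
set A := SupOn _ _ in s1 *; set B := SupOn _ _ in s2 * => gB gA.
have {gB}gB : - L (@relu R \o g) <= B := gB.
rewrite -/B -/A; set y := L _ in gA gB *.
by case: (ger0P y); lra.
Qed.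

Let rad_gauge_dual l xs :
  rad_avg (gauge_dual l) ev 0 xs <= 3 * Num.sqrt (2 * (size xs)%:R * ln (2 * d%:R)).
Proof.
have C0 := rad_maxcoord xs; set S := Num.sqrt _ in C0 *.
have S0 : 0 <= S by exact: sqrtr_ge0.
elim: l => [|l ih]; first by apply: le_trans C0 _; lra.
have bev x : bounded_on (ball l) (ev x).
  by exists 1 => g; exact: gauge_bound.
have brev x : bounded_on (ball l) (fun g => relu (g (pt x))).
  by exists 1 => g gl; apply: le_trans (relu_norm_le _) (gauge_bound (pt1 x) gl).
have bn : ball l !=set0 by exact: ball0.
(* Contraction removes the ReLU; what remains is the sign average of the [l]-th ball itself,
   controlled by the induction hypothesis. *)
have step : rad_avg (SupOn (ball l)) (fun x g => relu (g (pt x))) 0 xs <= 3 * S.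
  apply: le_trans (_ : rad_avg (SupOn (ball l)) ev 0 xs <= _).
    apply: rad_contraction => //; first exact: bounded_on0.
    by move=> x f g _ _; exact: relu_lip.
  apply: le_trans ih; apply: (rad_le (I := good_form)) => //.
  - by move=> L gL; rewrite -[leRHS]mul1r; exact: SupOn_gauge_dual.
have E1 : rad_avg (fun L : func -> R => SupOn (ball l) (fun g => L (@relu R \o g))) ev 0 xs =
    rad_avg (SupOn (ball l)) (fun x g => relu (g (pt x))) 0 xs.
  by rewrite (rad_comp (phi := fun (L : func -> R) (g : func) => L (@relu R \o g))).
(* The negated supremum has the same sign average, by flipping all signs. *)
have E2 : rad_avg (fun L : func -> R => SupOn (ball l) (fun g => - L (@relu R \o g))) ev 0 xs =
    rad_avg (SupOn (ball l)) (fun x g => relu (g (pt x))) 0 xs.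
  rewrite (rad_comp (phi := fun (L : func -> R) (g : func) => - L (@relu R \o g))).
  - rewrite -[RHS]radN; congr rad_avg; by apply/funext => g; rewrite fctE oppr0.
  - by move=> v w; apply/funext => g; rewrite !fctE opprD.
  - by move=> v w; apply/funext => g; rewrite !fctE opprD.
by rewrite radD radZ radD E1 E2; lra.
Qed.

Lemma rad_gauge l q xs : 0 <= q ->
  rad_avg (SupOn [set f | gauge l f q]) (fun x f => f (pt x)) 0 xs <=
  q * (3 * Num.sqrt (2 * (size xs)%:R * ln (2 * d%:R))).
Proof.
move=> q0; apply: le_trans (ler_wpM2l q0 (rad_gauge_dual l xs)).
rewrite -radZ; apply: (rad_le (I := good_form)) => //.
by move=> L; exact: SupOn_gauge_dual.
Qed.

End RademacherGauge.

End Gauge.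

(** * The Bellman loss on a finite space *)

Lemma bigmax_dist_le (R : realDomainType) (I : Type) (r : seq I) (F G : I -> R) (x y e : R) :
  `|x - y| <= e -> (forall i, `|F i - G i| <= e) ->
  `|\big[Num.max/x]_(i <- r) F i - \big[Num.max/y]_(i <- r) G i| <= e.
Proof.
move=> xy FG; elim: r => [|i r ih]; first by rewrite !big_nil.
rewrite !big_cons; move: (\big[_/_]_(_ <- _) _) (\big[_/_]_(_ <- _) _) ih => a b.
have := FG i; rewrite !ler_norml.
by case: (leP (F i) b); case: (leP (G i) a); lra.
Qed.

Section TDError.
Variables (R : realType) (d m D N alpha : nat) (gamma : R).
Hypothesis d0 : (0 < d)%N.
Hypothesis gamma01 : 0 < gamma < 1.
Implicit Types (Th : act_family R d m D N alpha) (s t : 'cV[R]_d) (a : 'I_(2 ^ alpha)) (b : R).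

(** Reward and next state are separate arguments, so that they can be compared with those of a cell
    representative. *)
Definition td_error Th s a (rho : R) s' : R :=
  resnet (Th a) s - rho - gamma * max_Q Th s'.

Definition small_family (B : R) := 
  [set Th : act_family R d m D N alpha | family_path_norm Th <= B].

Lemma path_norm_family_le Th a : path_norm (Th a) <= family_path_norm Th.
Proof.
rewrite /family_path_norm (bigD1 a)//= lerDl; apply: sumr_ge0 => i _.
exact: path_norm_ge0.
Qed.

Lemma family_path_norm_ge0 Th : 0 <= family_path_norm Th.
Proof. by apply: sumr_ge0 => i _; exact: path_norm_ge0. Qed.

Lemma small_family_gauge B Th a : small_family B Th -> gauge N (resnet (Th a)) B.
Proof.
move=> ThB; apply: gauge_le (gauge_resnet d0 (Th a)) => //.
exact: le_trans (path_norm_family_le Th a) ThB.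
Qed.

Lemma max_Q_bound B Th s : small_family B Th -> (forall j, `|s j 0| <= 1) ->
  `|max_Q Th s| <= B.
Proof.
move=> ThB s1; have h a : `|resnet (Th a) s| <= B.
  by apply: gauge_bound s1 (small_family_gauge a ThB).
rewrite ler_norml; apply/andP; split.
  apply: le_trans (bigmax_ge_id _ _ _ _).
  by have := h (act0 alpha); rewrite ler_norml => /andP[].
apply: bigmax_le => [|a _]; exact: le_trans (ler_norm _) (h _).
Qed.

Lemma td_error_bound B Th s a (rho : R) s' : small_family B Th ->
  (forall j, `|s j 0| <= 1) -> (forall j, `|s' j 0| <= 1) -> `|rho| <= 1 ->
  `|td_error Th s a rho s'| <= 2 * B + 1.
Proof.
move=> ThB s1 s1' rho1; rewrite /td_error.
have h1 : `|resnet (Th a) s| <= B by apply: gauge_bound s1 (small_family_gauge a ThB).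
have h2 := max_Q_bound ThB s1'.
have h3 : `|gamma * max_Q Th s'| <= B.
  case/andP: gamma01 => g0 g1.
  by rewrite normrM gtr0_norm// (le_trans _ h2)// ler_piMl// ltW.
by move: h1 h3 rho1; rewrite !ler_norml; lra.
Qed.

Lemma td_error_lip B Th s t a (rho sigma : R) s' t' b : small_family B Th ->
  (forall j, `|s j 0 - t j 0| <= b) -> (forall j, `|s' j 0 - t' j 0| <= b) ->
  `|rho - sigma| <= b ->
  `|td_error Th s a rho s' - td_error Th t a sigma t'| <= (2 * B + 1) * b.
Proof.
move=> ThB st st' rs; rewrite /td_error.
have h1 : `|resnet (Th a) s - resnet (Th a) t| <= B * b.
  by apply: gauge_lip st (small_family_gauge a ThB).
have h2 : `|max_Q Th s' - max_Q Th t'| <= B * b.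
  by apply: bigmax_dist_le => [|i]; apply: gauge_lip st' (small_family_gauge _ ThB).
have h3 : `|gamma * (max_Q Th s' - max_Q Th t')| <= B * b.
  case/andP: gamma01 => g0 g1.
  by rewrite normrM gtr0_norm// (le_trans _ h2)// ler_piMl// ltW.
by move: h1 h3 rs; rewrite mulrBr !ler_norml; lra.
Qed.

Lemma sqr_dist_le (M x y : R) : `|x| <= M -> `|y| <= M ->
  `|x ^+ 2 - y ^+ 2| <= 2 * M * `|x - y|.
Proof.
move=> xM yM; rewrite subr_sqr mulrC normrM ler_wpM2r//.
by apply: le_trans (ler_normD _ _) _; move: xM yM; lra.
Qed.

(** * Uniform deviation of the loss in the finite model *)

Section FiniteModel.
Variables (X : finType) (p : X -> R).
Hypothesis p_ge0 : forall x, 0 <= p x.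
Hypothesis p_sum : \sum_x p x = 1.
Variables (st nx : X -> 'cV[R]_d) (ac : X -> 'I_(2 ^ alpha)) (rw : X -> R).
Hypothesis st1 : forall x j, `|st x j 0| <= 1.
Hypothesis nx1 : forall x j, `|nx x j 0| <= 1.
Hypothesis rw1 : forall x, `|rw x| <= 1.

Let err x Th := td_error Th (st x) (ac x) (rw x) (nx x).
Let loss x Th := err x Th ^+ 2 / 2.

Let zero_family : act_family R d m D N alpha :=
  fun=> ResnetParam 0 0 (fun=> 0) (fun=> 0).

Lemma small_family_nonempty (B : R) : 0 <= B -> small_family B !=set0.
Proof.
move=> B0; exists zero_family; rewrite /small_family /= /family_path_norm big1// => a _.
have z (k l : nat) : mabs (0 : 'M[R]_(k, l)) = 0.
  by apply/matrixP => i j; rewrite !mxE normr0.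
by rewrite /path_norm big1// => j _; rewrite (_ : par_V (zero_family a) = 0)// z mulmx0 mxE normr0.
Qed.

Variable B : R.
Hypothesis B0 : 0 <= B.

Let C := small_family B.
Let C0 : C !=set0. Proof. exact: small_family_nonempty. Qed.
Let ebound n := 3 * Num.sqrt (2 * n%:R * ln (2 * d%:R)) : R.

Lemma rad_avg_resnet (pt : X -> 'cV[R]_d) a xs : (forall x j, `|pt x j 0| <= 1) ->
  rad_avg (SupOn C) (fun x Th => resnet (Th a) (pt x)) 0 xs <= B * ebound (size xs).
Proof.
move=> pt1; apply: le_trans (rad_gauge d0 pt1 N xs B0).
apply: (@rad_image _ _ _ _ _ C (fun Th => resnet (Th a)) (fun x f => f (pt x)) 0) => //.
- by move=> Th ThC; exact: small_family_gauge.
- exact: bounded_on0.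
- by move=> x; exists B => f fB; exact: gauge_bound (pt1 x) fB.
Qed.

Let bresnet (pt : X -> 'cV[R]_d) a x : (forall x j, `|pt x j 0| <= 1) ->
  bounded_on C (fun Th => resnet (Th a) (pt x)).
Proof.
by move=> pt1; exists B => Th ThC; apply: gauge_bound (pt1 x) (small_family_gauge a ThC).
Qed.

Lemma rad_avg_bigmax (I : Type) (r : seq I) (F0 : X -> act_family R d m D N alpha -> R)
    (F : I -> X -> act_family R d m D N alpha -> R) xs :
  (forall x, bounded_on C (F0 x)) -> (forall i x, bounded_on C (F i x)) ->
  rad_avg (SupOn C) (fun x Th => \big[Num.max/F0 x Th]_(i <- r) F i x Th) 0 xs <=
  rad_avg (SupOn C) F0 0 xs + \sum_(i <- r) rad_avg (SupOn C) (F i) 0 xs.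
Proof.
move=> b0 bF; elim: r => [|i r ih].
  rewrite big_nil addr0 (_ : (fun x Th => _) = F0)//.
  by apply/funext => x; apply/funext => Th; rewrite big_nil.
have bm x : bounded_on C (fun Th => \big[Num.max/F0 x Th]_(i <- r) F i x Th).
  elim: r {ih} => [|j r ih].
    by rewrite (_ : (fun Th => _) = F0 x)//; apply/funext => Th; rewrite big_nil.
  case: ih (bF j x) => [M1 h1] [M2 h2]; exists (Num.max M1 M2) => Th ThC.
  have k1 := h1 _ ThC; have k2 := h2 _ ThC; rewrite big_cons le_max.
  by case: (leP (F j x Th) _) => _; rewrite ?k1 ?k2 ?orbT.
have -> : (fun x Th => \big[Num.max/F0 x Th]_(j <- i :: r) F j x Th) =
    (fun x Th => Num.max (F i x Th) (\big[Num.max/F0 x Th]_(j <- r) F j x Th)).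
  by apply/funext => x; apply/funext => Th; rewrite big_cons.
apply: le_trans (rad_max_le C0 _ (bF i) bm) _.
by rewrite big_cons addrCA lerD2l.
Qed.

Lemma rad_avg_max_Q xs :
  rad_avg (SupOn C) (fun x Th => max_Q Th (nx x)) 0 xs <= (2 ^ alpha)%:R * (B * ebound (size xs)).
Proof.
(* [max_Q] starts from [act0] and meets it again in its range; dropping the repetition gives
   [2 ^ alpha] terms instead of [2 ^ alpha + 1]. *)
have -> : (fun x Th => max_Q Th (nx x)) = (fun x Th =>
    \big[Num.max/resnet (Th (act0 alpha)) (nx x)]_(a <-
        [seq a <- enum 'I_(2 ^ alpha) | a != act0 alpha])
      resnet (Th a) (nx x)).
  apply/funext => x; apply/funext => Th; rewrite /max_Q (bigmaxD1 (act0 alpha))//.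
  by rewrite big_filter big_enum_cond/= [RHS]bigmax_idl.
apply: le_trans (rad_avg_bigmax _ _ (bresnet _ ^~ nx1) (fun a x => bresnet a x nx1)) _.
rewrite big_filter big_enum_cond/=.
apply: le_trans (_ : \sum_(a < 2 ^ alpha) B * ebound (size xs) <= _); last first.
  by rewrite sumr_const card_ord mulr_natl.
rewrite [leRHS](bigD1 (act0 alpha))//=; apply: lerD; first exact: rad_avg_resnet.
by apply: ler_sum => a _; exact: rad_avg_resnet.
Qed.

Lemma rad_avg_action_value xs :
  rad_avg (SupOn C) (fun x Th => resnet (Th (ac x)) (st x)) 0 xs <=
  (2 ^ alpha)%:R * (B * ebound (size xs)).
Proof.
(* A network vanishes at the origin, so that masking an action amounts to moving
   the sample point to the origin. *)
pose pt a x := if ac x == a then st x else 0.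
have pt1 a x j : `|pt a x j 0| <= 1 by rewrite /pt; case: ifP; rewrite // mxE normr0.
have res0 a Th : resnet (Th a) 0 = 0 by exact: gauge_at0 (gauge_resnet d0 (Th a)).
have -> : (fun x Th => resnet (Th (ac x)) (st x)) =
    (fun x => \sum_a (fun Th => resnet (Th a) (pt a x))).
  apply/funext => x; apply/funext => Th; rewrite fct_sumE (bigD1 (ac x))//= {1}/pt eqxx.
  rewrite big1 ?addr0// => a /negbTE aa; by rewrite /pt eq_sym aa res0.
apply: le_trans (rad_sum_le C0 _ _ (G := fun a x Th => resnet (Th a) (pt a x)) _) _.
  by move=> a x; exact: (bresnet a x (pt1 a)).
apply: le_trans (_ : \sum_(a < 2 ^ alpha) B * ebound (size xs) <= _); last first.
  by rewrite sumr_const card_ord mulr_natl.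
by apply: ler_sum => a _; exact: rad_avg_resnet.
Qed.

Let M := 2 * B + 1.
Let K : R := (2 ^ alpha)%:R.

Let M_gt0 : 0 < M.
Proof. by rewrite /M ltr_wpDl// mulr_ge0. Qed.

Let berr x : bounded_on C (err x).
Proof. by exists M => Th ThC; apply: td_error_bound ThC _ _ _. Qed.

Lemma rad_avg_err xs : rad_avg (SupOn C) err 0 xs <= 2 * K * (B * ebound (size xs)).
Proof.
have b1 x : bounded_on C (fun Th => resnet (Th (ac x)) (st x)) by exact: (bresnet (ac x) x st1).
have b2 x : bounded_on C (fun Th => max_Q Th (nx x)).
  by exists B => Th ThC; exact: max_Q_bound.
have b3 x : bounded_on C (fun Th => - (gamma * max_Q Th (nx x))).
  apply: (bounded_on_le (v := fun Th => max_Q Th (nx x)) (a := 1)) => // Th _.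
  by case/andP: gamma01 => g0 g1; rewrite normrN normrM gtr0_norm// ler_wpM2r// ltW.
pose G1 x (Th : act_family R d m D N alpha) := resnet (Th (ac x)) (st x).
pose G2 x (Th : act_family R d m D N alpha) := - (gamma * max_Q Th (nx x)).
have b12 x : bounded_on C (G1 x + G2 x) by apply: bounded_onD; [exact: b1|exact: b3].
have bz := bounded_on0 R C.
(* The reward does not depend on the family, so contraction, which sees only increments, discards
   it. *)
apply: le_trans (_ : rad_avg (SupOn C) (fun x => G1 x + G2 x) 0 xs <= _).
  apply: rad_contraction => // x Th Th' _ _; rewrite le_eqVlt; apply/orP; left; apply/eqP.
  by rewrite /err /td_error !fctE /G1 /G2; congr `|_|; ring.
have := rad_subadd C0 xs bz bz b1 b3; rewrite addr0 => /le_trans; apply.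
have h1 := rad_avg_action_value xs; have h2 := rad_avg_max_Q xs.
have h3 : rad_avg (SupOn C) G2 0 xs <= rad_avg (SupOn C) (fun x Th => max_Q Th (nx x)) 0 xs.
  apply: rad_contraction => // x Th Th' _ _; rewrite /G2 -opprD normrN -mulrBr normrM.
  by case/andP: gamma01 => g0 g1; rewrite gtr0_norm// ler_piMl// ltW.
by rewrite -/G2; rewrite -/K in h1 h2; move: h1 h2 h3; lra.
Qed.

(** Stated for any [l] with the increments of [loss], in order to cover both [loss] and its
    reflection [c - loss]. *)
Lemma rad_avg_loss (l : X -> act_family R d m D N alpha -> R) xs : (forall x, bounded_on C (l x)) ->
  (forall x Th Th', `|l x Th - l x Th'| = `|loss x Th - loss x Th'|) ->
  rad_avg (SupOn C) (fun x Th => 2 * l x Th) 0 xs <=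
  12 * K * M * B * Num.sqrt (2 * (size xs)%:R * ln (2 * d%:R)).
Proof.
move=> bl lE; have M0 : 0 <= 2 * M by rewrite mulr_ge0// ltW.
apply: le_trans (_ : rad_avg (SupOn C) (fun x Th => 2 * M * err x Th) 0 xs <= _).
  apply: rad_contraction => //.
  - exact: bounded_on0.
  - by move=> x; apply: (bounded_on_le (v := l x) (a := 2)) => // Th _; rewrite normrM ger0_norm.
  - move=> x; apply: (bounded_on_le (v := err x) (a := 2 * M)) => // Th _.
    by rewrite normrM ger0_norm.
  - move=> x Th Th' ThC ThC'.
    rewrite -!mulrBr (normrM 2) lE -normrM (normrM (2 * M)) (ger0_norm M0).
    have -> : 2 * (loss x Th - loss x Th') = err x Th ^+ 2 - err x Th' ^+ 2 by rewrite /loss; field.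
    by apply: sqr_dist_le; apply: td_error_bound.
have := @rad_le_scale _ _ _ _ C0 (2 * M) err 0 xs M0 (bounded_on0 _ _) berr.
rewrite (_ : (fun t : act_family R d m D N alpha => 2 * M * _) = 0); last first.
  by apply/funext => t; rewrite mulr0.
move=> /le_trans; apply; apply: le_trans (ler_wpM2l M0 (rad_avg_err xs)) _.
by rewrite le_eqVlt; apply/orP; left; apply/eqP; rewrite /ebound; ring.
Qed.

Let mean Th := \sum_x p x * loss x Th.

Let loss_bound x Th : C Th -> 0 <= loss x Th <= M ^+ 2 / 2.
Proof.
move=> ThC; rewrite /loss divr_ge0 ?sqr_ge0//= ler_pM2r ?invr_gt0//.
rewrite -real_normK ?num_real// ler_sqr ?nnegrE//; first exact: td_error_bound.
exact: ltW.
Qed.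

Let bloss x : bounded_on C (loss x).
Proof. by exists (M ^+ 2 / 2) => Th ThC; case/andP: (loss_bound x ThC) => h; rewrite ger0_norm. Qed.

(** The two-sided bound applies [uniform_deviation] to [loss] and to [c - loss], which again takes
    values in [[0, c]] and has the opposite deviation; hence the factor 2. *)
Lemma loss_deviation n tau : (0 < n)%N -> 0 < tau ->
  iid_mean p n (fun s : seq X => `[< exists2 Th, C Th &
    12 * K * M * B * Num.sqrt (2 * n%:R * ln (2 * d%:R)) + tau <=
      `|\sum_(x <- s) (mean Th - loss x Th)| >]%:R) <=
  2 * expR (- (tau ^+ 2 / (n%:R * (M ^+ 2 / 2) ^+ 2))).
Proof.
move=> n0 tau0; set rho := 12 * _ * _ * _ * _; set c := M ^+ 2 / 2.
have c0 : 0 < c by rewrite /c divr_gt0// exprn_gt0.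
have := uniform_deviation p_ge0 p_sum C0 bloss (rho := rho) n0 c0 tau0 loss_bound.
have lb' x Th : C Th -> 0 <= c - loss x Th <= c by move=> /(loss_bound x); rewrite -/c; lra.
have bl' x : bounded_on C (fun Th => c - loss x Th).
  by exists c => Th /(lb' x)/andP[h h']; rewrite ger0_norm.
have := uniform_deviation p_ge0 p_sum C0 bl' (rho := rho) n0 c0 tau0 lb'.
have h1 (s : seq X) : size s = n -> rad_avg (SupOn C) (fun x Th => 2 * (c - loss x Th)) 0 s <= rho.
  move=> sn; rewrite /rho -sn; apply: rad_avg_loss => // x Th Th'.
  by rewrite -[RHS]normrN; congr `|_|; ring.
have h2 (s : seq X) : size s = n -> rad_avg (SupOn C) (fun x Th => 2 * loss x Th) 0 s <= rho.
  by move=> sn; rewrite /rho -sn; exact: rad_avg_loss.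
move=> /(_ h1) D1 /(_ h2) D2.
rewrite mulr2n mulrDl mul1r; apply: le_trans (lerD D2 D1).
rewrite -iid_meanD; apply: iid_mean_le => // s _; rewrite -natrD ler_nat.
case: asboolP => // -[Th ThC hTh].
have := hTh; case: (ger0P (\sum_(x <- s) (mean Th - loss x Th))) => _ h.
  by rewrite (asboolT (P := exists2 t, _ & _)) ?addn1 ?leq_addr//; exists Th.
rewrite addnC (asboolT (P := exists2 t, _ & _)) ?leq_addr//; exists Th => //.
apply: le_trans h _; rewrite -sumrN le_eqVlt; apply/orP; left; apply/eqP.
apply: eq_bigr => x _; rewrite /mean.
under [in RHS]eq_bigr do rewrite mulrBr.
by rewrite sumrB -mulr_suml p_sum; ring.
Qed.

End FiniteModel.

End TDError.

(** There are finitely many samples of size [n], so one index per bad sample gives a finite union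
    with the same indicator. Only finite partial sums of [e] are then needed. *)
Lemma iid_mean_union (R : realType) (X : finType) (p : X -> R) n
    (P : nat -> seq X -> bool) (e : nat -> R) (delta : R) :
  (forall x, 0 <= p x) ->
  (forall k, iid_mean p n (fun s => (P k s)%:R) <= e k) ->
  (forall N, \sum_(k < N) e k <= delta) ->
  iid_mean p n (fun s => `[< exists k, P k s >]%:R) <= delta.
Proof.
move=> p0 Pe eN.
(* The successor of a chosen bad index, or 0 if there is none, so that every chosen index is
   strictly below [N]. *)
pose f (t : n.-tuple X) : nat :=
  if pselect (exists k, P k t) is left h then (xchoose h).+1 else 0%N.
pose N := \max_t f t.
have HN s : size s = n -> (exists k, P k s) -> exists2 k : 'I_N, true & P k s.
  move=> sn h; pose t := @Tuple n X s (introT eqP sn).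
  have : (f t <= N)%N by exact: leq_bigmax.
  rewrite /f; case: pselect => // h' lt.
  by exists (Ordinal lt) => //; exact: (xchooseP h').
apply: le_trans (eN N).
apply: le_trans (_ : \sum_(k < N) iid_mean p n (fun s => (P k s)%:R) <= _); last first.
  by apply: ler_sum => k _; exact: Pe.
rewrite -iid_mean_sum; apply: iid_mean_le => // s sn.
case: asboolP => [/(HN s sn)[k _ Pk]|_]; last by apply: sumr_ge0 => k _; rewrite ler0n.
by rewrite (bigD1 k)//= Pk lerDl sumr_ge0// => i _; rewrite ler0n.
Qed.

Lemma sum_telescoping_inv (R : realType) (delta : R) N : 0 <= delta ->
  \sum_(k < N) delta / (k.+1%:R * (k.+1%:R + 1)) <= delta.
Proof.
move=> d0; have -> : \sum_(k < N) delta / (k.+1%:R * (k.+1%:R + 1)) = delta * (1 - N.+1%:R^-1).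
  elim: N => [|N ih]; first by rewrite big_ord0 invr1 subrr mulr0.
  rewrite big_ord_recr/= ih -[N.+2%:R]natr1.
  have n0 : 0 < N.+1%:R :> R by rewrite ltr0n.
  by field; rewrite !gt_eqF// ltr_wpDr.
by rewrite ler_piMr// gerBl invr_ge0.
Qed.

(** The bound for the sign average plus the McDiarmid term, for sums rather than means. In the
    logarithm, [B * (B + 1) / delta] is the inverse failure probability of level [B], and 2 accounts
    for the two signs of the deviation. *)
Definition deviation_threshold (R : realType) (d alpha n : nat) (delta B : R) : R :=
  12 * (2 ^ alpha)%:R * (2 * B + 1) * B * Num.sqrt (2 * n%:R * ln (2 * d%:R)) +
  (2 * B + 1) ^+ 2 / 2 * Num.sqrt (n%:R * ln (2 * B * (B + 1) / delta)).

(** [expR (-1/10) >= 9/10], and the twelfth power of 9/10 exceeds 1/4. The value 6/5 is what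
    [deviation_threshold_le] needs to leave room for the discretization error. *)
Lemma ln4_ge (R : realType) : 6 / 5 <= ln 4 :> R.
Proof.
rewrite -[leLHS]expRK ler_ln ?posrE ?expR_gt0//.
have e1 : (9 / 10) <= expR (- 10^-1) :> R by apply: le_trans (expR_ge1Dx _); lra.
have -> : 6 / 5 = (12%:R * 10^-1 : R) by field.
rewrite expRM_natl -[expR _]invrK -expRN exprVn.
have : (9 / 10) ^+ 12 <= expR (- 10^-1) ^+ 12 :> R by rewrite lerXn2r// ?nnegrE ?expR_ge0//; lra.
have h : 4^-1 <= (9 / 10) ^+ 12 :> R by lra.
move=> /(le_trans h) => h2; rewrite -[leRHS]invrK lef_pV2// posrE ?exprn_gt0 ?expR_gt0//.
Qed.

Lemma deviation_threshold_le (R : realType) (d alpha n : nat) (delta Q B : R) :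
  (0 < d)%N -> (0 < n)%N -> 0 < delta < 1 -> 0 <= Q -> 1 <= B -> B <= Q + 1 ->
  deviation_threshold d alpha n delta B / n%:R + 2 * ((2 * B + 1) ^+ 2 / (40 * n%:R)) <=
  gen_bound d alpha n delta Q.
Proof.
move=> d0 n0 /andP[delta0 delta1] Q0 B1 BQ.
set K : R := (2 ^ alpha)%:R.
have K1 : 1 <= K by rewrite /K ler1n expn_gt0.
have n1 : 1 <= n%:R :> R by rewrite ler1n.
have n0' : 0 < n%:R :> R by lra.
set r := Num.sqrt (n%:R : R).
have r1 : 1 <= r by rewrite -sqrtr1 ler_wsqrtr.
have r0 : 0 < r by lra.
have rr : r * r = n%:R by rewrite -expr2 sqr_sqrtr// ltW.
have L0 := @ln2d_gt0 R d d0.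
set S := Num.sqrt (2 * ln (2 * d%:R : R)).
have S0 : 0 <= S by exact: sqrtr_ge0.
have SE : Num.sqrt (2 * n%:R * ln (2 * d%:R)) = r * S :> R.
  by rewrite -sqrtrM ?ltW//; congr Num.sqrt; ring.
set x := ln (4 * (Q + 1)) + ln (K / delta).
set y := ln (2 * B * (B + 1) / delta).
have y0 : 0 < y.
  rewrite ln_gt0// ltr_pdivlMr// mul1r (lt_le_trans delta1)//.
  have h : 1 <= B * (B + 1) by nra.
  by lra.
have TE : Num.sqrt (n%:R * y) = r * Num.sqrt y by rewrite sqrtrM ?ltW.
pose q := ln (Q + 1).
have q0 : 0 <= q by rewrite ln_ge0//; lra.
have ld : 0 <= ln (K / delta).
  by rewrite ln_ge0// ler_pdivlMr// mul1r; lra.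
have xE : x = ln 4 + q + ln (K / delta) by rewrite /x lnM ?posrE//; lra.
have l4 := ln4_ge R.
have xq : q + 6 / 5 <= x by rewrite xE; lra.
have yx : y <= x + q.
  have -> : x + q = ln (4 * (Q + 1) * (K / delta) * (Q + 1)).
    have pos1 : 0 < 4 * (Q + 1) by lra.
    have pos2 : 0 < K / delta by rewrite divr_gt0//; lra.
    have pos3 : 0 < Q + 1 by lra.
    by rewrite lnM ?posrE ?(mulr_gt0 pos1 pos2)// lnM ?posrE.
  rewrite ler_ln ?posrE; last 2 first.
  - by rewrite divr_gt0// !mulr_gt0//; lra.
  - by rewrite !mulr_gt0 ?invr_gt0//; lra.
  rewrite mulrA -[leRHS]mulrAC ler_pM2r ?invr_gt0//.
  have h1 : B * (B + 1) <= (Q + 1) * (Q + 1 + 1) by apply: ler_pM; lra.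
  have h2 : (Q + 1) * (Q + 1) * 1 <= (Q + 1) * (Q + 1) * K by rewrite ler_wpM2l// mulr_ge0//; lra.
  by nra.
(* [y <= x + q <= 2 * x - 6/5], and this is at most [(x - 1/10)^2] because the difference is
   [(x - 11/10)^2]. The spare 1/10, multiplied by [M ^+ 2 / 2], pays exactly the discretization term
   [M ^+ 2 / 20]. *)
have T : Num.sqrt y <= x - 10^-1.
  have x1 : 0 <= x - 10^-1 by lra.
  by rewrite -[leRHS](ger0_norm x1) -sqrtr_sqr ler_wsqrtr//; nra.
have MB : (2 * B + 1) * B <= 3 * (Q + 1) ^+ 2 by nra.
have MM : (2 * B + 1) ^+ 2 <= 9 * (Q + 1) ^+ 2 by nra.
have KK : K <= K ^+ 3 by rewrite -[leLHS]expr1 ler_weXn2l.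
rewrite /deviation_threshold /gen_bound -/K -/r -/S -/x -/y SE TE -rr.
set M := 2 * B + 1 in MB MM *; set T' := Num.sqrt y in T *.
have T0 : 0 <= T' by exact: sqrtr_ge0.
have rV : r^-1 * r^-1 <= r^-1 by rewrite ler_piMl ?invr_ge0 ?(ltW r0)// invf_le1.
have rV0 : 0 < r^-1 by rewrite invr_gt0.
have -> : (12 * K * M * B * (r * S) + M ^+ 2 / 2 * (r * T')) / (r * r) +
    2 * (M ^+ 2 / (40 * (r * r))) =
  r^-1 * (12 * K * (M * B) * S + M ^+ 2 / 2 * T') + (r^-1 * r^-1) * (M ^+ 2 / 20).
  by field; rewrite gt_eqF.
set P := (Q + 1) ^+ 2 in MB MM *.
have P0 : 0 <= P by exact: sqr_ge0.
apply: le_trans (_ : r^-1 * (12 * K * (M * B) * S + M ^+ 2 / 2 * T') + r^-1 * (M ^+ 2 / 20) <= _).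
  by rewrite lerD2l ler_wpM2r// divr_ge0// sqr_ge0.
rewrite -mulrDr [leRHS]mulrAC mulrC ler_pM2r//.
have h1 : 12 * K * (M * B) * S <= P * (36%:R * K ^+ 3 * S).
  have -> : 12 * K * (M * B) * S = 12 * S * (K * (M * B)) by ring.
  have -> : P * (36%:R * K ^+ 3 * S) = 12 * S * (K ^+ 3 * (3 * P)) by ring.
  have MB0 : 0 <= M * B by rewrite mulr_ge0// /M; lra.
  by rewrite ler_wpM2l ?mulr_ge0// ler_pM// ler0n.
have h2 : M ^+ 2 / 2 * T' + M ^+ 2 / 20 <= P * (9%:R / 2 * x).
  have -> : M ^+ 2 / 2 * T' + M ^+ 2 / 20 = M ^+ 2 * (2^-1 * (T' + 10^-1)) by field.
  have -> : P * (9%:R / 2 * x) = 9 * P * (2^-1 * x) by field.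
  by rewrite ler_pM ?sqr_ge0 ?mulr_ge0//; lra.
by rewrite mulrDr; lra.
Qed.

Section FiniteGeneralization.
Variables (R : realType) (d m D N alpha : nat) (gamma : R).
Hypothesis d0 : (0 < d)%N.
Hypothesis gamma01 : 0 < gamma < 1.
Variables (X : finType) (p : X -> R).
Hypothesis p_ge0 : forall x, 0 <= p x.
Hypothesis p_sum : \sum_x p x = 1.
Variables (st nx : X -> 'cV[R]_d) (ac : X -> 'I_(2 ^ alpha)) (rw : X -> R).
Hypothesis st1 : forall x j, `|st x j 0| <= 1.
Hypothesis nx1 : forall x j, `|nx x j 0| <= 1.
Hypothesis rw1 : forall x, `|rw x| <= 1.

Let loss x (Th : act_family R d m D N alpha) :=
  td_error gamma Th (st x) (ac x) (rw x) (nx x) ^+ 2 / 2.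

Lemma finite_generalization n (delta : R) : (0 < n)%N -> 0 < delta < 1 ->
  iid_mean p n (fun s => `[< exists k : nat,
     `[< exists2 Th : act_family R d m D N alpha, small_family k.+1%:R Th &
     deviation_threshold d alpha n delta k.+1%:R <=
       `|\sum_(x <- s) ((\sum_y p y * loss y Th) - loss x Th)| >] >]%:R) <= delta.
Proof.
move=> n0 /andP[delta0 delta1].
apply: (iid_mean_union (e := fun k => delta / (k.+1%:R * (k.+1%:R + 1)))) => //; last first.
  by move=> M; apply: sum_telescoping_inv; exact: ltW.
move=> k; set B : R := k.+1%:R.
have B1 : 1 <= B by rewrite /B ler1n.
have B0 : 0 <= B by exact: ler0n.
set y := 2 * B * (B + 1) / delta.
have y1 : 1 < y.
  rewrite ltr_pdivlMr// mul1r (lt_le_trans delta1)//.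
  have h : 1 <= B * (B + 1) by nra.
  by lra.
have n0' : 0 < n%:R :> R by rewrite ltr0n.
have M0 : 0 < (2 * B + 1) ^+ 2 / 2 by rewrite divr_gt0// exprn_gt0//; lra.
(* Chosen so that the failure probability is [2 * expR (- ln y) = 2 / y = delta / (B * (B + 1))]. *)
pose tau := (2 * B + 1) ^+ 2 / 2 * Num.sqrt (n%:R * ln y).
have ly : 0 < ln y by exact: ln_gt0.
have tau0 : 0 < tau by rewrite mulr_gt0// sqrtr_gt0 mulr_gt0.
have := loss_deviation m D N d0 gamma01 p_ge0 p_sum ac st1 nx1 rw1 B0 n0 tau0.
move=> /le_trans; apply.
rewrite /tau exprMn sqr_sqrtr ?mulr_ge0 ?(ltW ly)//.
have -> : ((2 * B + 1) ^+ 2 / 2) ^+ 2 * (n%:R * ln y) / (n%:R * ((2 * B + 1) ^+ 2 / 2) ^+ 2) = ln y.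
  by field; rewrite !gt_eqF//; lra.
rewrite expRN lnK ?posrE; last by lra.
rewrite /y le_eqVlt; apply/orP; left; apply/eqP.
by field; rewrite !gt_eqF//; lra.
Qed.

End FiniteGeneralization.

(** * Measurability and discretization *)

Section BorelRd.
Variables (R : realType) (d : nat).
Implicit Types (A : set (Rd R d)).

Lemma open_measurable_Rd (A : set 'cV[R]_d) : open A -> measurable (A : set (Rd R d)).
Proof. by move=> oA; exact: sub_sigma_algebra. Qed.

Lemma closed_measurable_Rd (A : set 'cV[R]_d) : closed A -> measurable (A : set (Rd R d)).
Proof. by move=> /closed_openC/open_measurable_Rd/measurableC; rewrite setCK. Qed.

Lemma compact_measurable_Rd (A : set 'cV[R]_d) : compact A -> measurable (A : set (Rd R d)).
Proof.
move=> cA; apply: closed_measurable_Rd.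
exact: (compact_closed (@norm_hausdorff R 'cV[R]_d) cA).
Qed.

Lemma within_continuous_measurable_Rd (A : set 'cV[R]_d) (f : 'cV[R]_d -> R) :
  measurable (A : set (Rd R d)) -> {within A, continuous f} ->
  measurable_fun (A : set (Rd R d)) (f : Rd R d -> R).
Proof.
move=> mA /continuousP cf; apply: (measurability _ (RGenOpens.measurableE R)).
move=> _ [_ [a [b ->] <-]].
have oab : open (`]a, b[%classic : set R) by exact: interval_open.
have /open_subspaceP[V oV VA] := cf _ oab.
rewrite setIC -VA; apply: measurableI => //; exact: open_measurable_Rd.
Qed.

Lemma continuous_measurable_Rd (f : 'cV[R]_d -> R) : continuous f ->
  measurable_fun (setT : set (Rd R d)) (f : Rd R d -> R).
Proof.
move=> /continuousP cf; apply: (measurability _ (RGenOpens.measurableE R)).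
move=> _ [_ [a [b ->] <-]]; rewrite setTI.
have oab : open (`]a, b[%classic : set R) by exact: interval_open.
exact: open_measurable_Rd (cf _ oab).
Qed.

Lemma gauge_continuous l f (q : R) : (0 < d)%N -> 0 <= q -> gauge l f q ->
  continuous (f : 'cV[R]_d -> R).
Proof.
move=> d0 q0 fq x; apply/(@cvgrPdist_lt R R 'cV[R]_d (nbhs x) _ f (f x)) => e e0.
have k0 : 0 < e / (q + 1) by rewrite divr_gt0// ltr_wpDl.
near=> y; have xy : @ball R 'cV[R]_d x (e / (q + 1)) y.
  by near: y; exact: (@nbhsx_ballx R 'cV[R]_d x _ k0).
have {}xy j : `|x j 0 - y j 0| <= e / (q + 1) by case: xy => _ xy; apply/ltW; exact: (xy j 0).
apply: le_lt_trans (gauge_lip d0 xy fq) _.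
by rewrite mulrCA -[ltRHS]mulr1 ltr_pM2l// ltr_pdivrMr ?mul1r ?ltrDl// ltr_wpDl.
Unshelve. all: by end_near. Qed.

End BorelRd.

(** * Rounding to a finite measurable partition *)

Section Quantization.
Variables (R : realType) (disp : measure_display) (T : measurableType disp).
Variables (I : finType) (S : set T) (phi : I -> T -> R) (n : nat).
Hypothesis n0 : (0 < n)%N.
Hypothesis mS : measurable S.
Hypothesis mphi : forall k, measurable_fun S (phi k).
Hypothesis phi1 : forall k s, S s -> `|phi k s| <= 1.

(** The rescaled value ranges over [[0, 2n]], and the endpoint [2n] occurs when [phi k s = 1], hence
    [2n + 1] levels. *)
Definition quantize (s : T) : {ffun I -> 'I_(2 * n).+1} :=
  [ffun k => inord (Num.truncn ((phi k s + 1) * n%:R))].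

Let scaled_ge0 k s : S s -> 0 <= (phi k s + 1) * n%:R.
Proof. by move=> /(phi1 k); rewrite ler_norml => /andP[? _]; rewrite mulr_ge0//; lra. Qed.

Let quantizeE k s : S s -> quantize s k = Num.truncn ((phi k s + 1) * n%:R) :> nat.
Proof.
move=> Ss; rewrite ffunE inordK//; rewrite ltnS truncn_le_nat -natr1 natrM.
have := phi1 k Ss; rewrite ler_norml => /andP[_ p1].
have h : (phi k s + 1) * n%:R <= 2 * n%:R by rewrite ler_wpM2r//; lra.
by rewrite (le_lt_trans h)// ltrDl.
Qed.

Lemma quantize_close k s t : S s -> S t -> quantize s = quantize t ->
  `|phi k s - phi k t| <= n%:R^-1.
Proof.
move=> Ss St st; have n0' : 0 < n%:R :> R by rewrite ltr0n.
have /(congr1 (@nat_of_ord _)) := congr1 (fun f : {ffun I -> 'I_(2 * n).+1} => f k) st.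
rewrite /= !quantizeE// => E.
have /andP[a1 a2] := truncn_itv (scaled_ge0 k Ss).
have /andP[b1 b2] := truncn_itv (scaled_ge0 k St).
rewrite E in a1 a2; rewrite -natr1 in a2 b2.
rewrite -(ler_pM2r n0') mulVf ?gt_eqF// -[X in _ * X](gtr0_norm n0') -normrM ler_norml.
by rewrite mulrDl mulNr; move: a1 a2 b1 b2; rewrite !mulrDl mul1r; lra.
Qed.

Lemma measurable_quantize c : measurable (S `&` quantize @^-1` [set c]).
Proof.
have -> : S `&` quantize @^-1` [set c] = S `&` \bigcap_(k in [set: I])
    (S `&` phi k @^-1` [set` `[(c k)%:R / n%:R - 1, (c k).+1%:R / n%:R - 1[ ]).
  have n0' : 0 < n%:R :> R by rewrite ltr0n.
  apply/seteqP; split=> s [Ss h]; split=> //.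
    move=> k _; split => //=; rewrite in_itv/=.
    rewrite lerBlDr ltrBrDr ler_pdivrMr// ltr_pdivlMr//.
    by rewrite -[c]h quantizeE//; exact: truncn_itv (scaled_ge0 k Ss).
  apply/ffunP => k; apply/val_inj => /=; rewrite quantizeE//.
  have [_ /=] := h k Logic.I; rewrite in_itv/=.
  rewrite lerBlDr ltrBrDr ler_pdivrMr// ltr_pdivlMr// => /truncn_def; exact.
apply: measurableI => //; apply: fin_bigcap_measurable => // k _.
by apply: mphi => //; exact: measurable_itv.
Qed.

End Quantization.

Section Measures.
Variables (R : realType) (disp : measure_display) (T : measurableType disp).

Lemma measure_big_disjoint (mu : {measure set T -> \bar R}) (I : finType) (P : pred I)
    (F : I -> set T) :
  (forall i, measurable (F i)) -> (forall i j w, F i w -> F j w -> i = j) ->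
  mu [set w | exists2 i, P i & F i w] = (\sum_(i | P i) mu (F i))%E.
Proof.
move=> mF disj.
have -> : [set w | exists2 i, P i & F i w] =
    \big[setU/set0]_(k < #|P|) F (enum_val k).
  have -> : [set w | exists2 i, P i & F i w] = \bigcup_(i in [set` P]) F i by [].
  by rewrite bigcup_pred big_enum_val.
rewrite measure_bigsetU_ord//; last first.
  by move=> i j _ _ [w [Fi Fj]]; apply: enum_val_inj; exact: disj Fi Fj.
by rewrite -(big_enum_val (A := P) (fun i => mu (F i))).
Qed.

Lemma integral_close (mu : {measure set T -> \bar R}) (A : set T) (f : T -> R) (c eta v : R) :
  measurable A -> mu A = v%:E -> measurable_fun A f -> 0 <= c -> 0 <= eta ->
  (forall s, A s -> 0 <= f s) -> (forall s, A s -> `|f s - c| <= eta) ->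
  exists2 y : R, (\int[mu]_(s in A) (f s)%:E)%E = y%:E & `|y - c * v| <= eta * v.
Proof.
move=> mA muA mf c0 eta0 f0 fc.
have mfE : measurable_fun A (EFin \o f) by exact/measurable_EFinP.
have cstE (a : R) : (\int[mu]_(s in A) a%:E)%E = (a * v)%:E.
  by have := integral_cst mu mA a%:E; rewrite /cst /= => ->; rewrite muA EFinM.
have up : (\int[mu]_(s in A) (f s)%:E <= ((c + eta) * v)%:E)%E.
  rewrite -cstE; apply: ge0_le_integral => //.
  by move=> s As; rewrite lee_fin; have := fc s As; rewrite ler_norml; lra.
have ge0 : (0 <= \int[mu]_(s in A) (f s)%:E)%E.
  by apply: integral_ge0 => s As; rewrite lee_fin f0.
have fin : (\int[mu]_(s in A) (f s)%:E)%E \is a fin_num.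
  by rewrite ge0_fin_numE// (le_lt_trans up)// ltry.
exists (fine (\int[mu]_(s in A) (f s)%:E)); first by rewrite fineK.
(* The error is added on the integral side, since [c - eta] may be negative and the integrals are
   compared for nonnegative functions. *)
have lo : ((c * v)%:E <= \int[mu]_(s in A) (f s)%:E + (eta * v)%:E)%E.
  rewrite -!cstE -ge0_integralD//.
  apply: ge0_le_integral => //.
  - by apply: emeasurable_funD => //; exact: measurable_cst.
  - by move=> s As; rewrite -EFinD lee_fin; have := fc s As; rewrite ler_norml; lra.
move: up lo; rewrite -(fineK fin) -EFinD !lee_fin ler_norml mulrDl; lra.
Qed.

Section Partition.
Variables (mu : {measure set T -> \bar R}) (J : finType) (S : set T) (q : T -> J).
Hypothesis mS : measurable S.
Let cell j := S `&` q @^-1` [set j].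
Hypothesis mcell : forall j, measurable (cell j).
Variable V : R.
Hypothesis muS : mu S = V%:E.

Lemma measure_cellE j : mu (cell j) = (fine (mu (cell j)))%:E.
Proof.
rewrite fineK// ge0_fin_numE//; apply: le_lt_trans (ltry V); rewrite -muS.
by apply: le_measure; rewrite ?inE//; exact: subIsetl.
Qed.

Lemma measure_cell_sum : \sum_j fine (mu (cell j)) = V.
Proof.
apply: EFin_inj; rewrite -muS -sumEFin.
under eq_bigr do rewrite -measure_cellE.
rewrite -measure_big_disjoint//; last by move=> i j w [_ <-] [_ <-].
by congr (mu _); apply/seteqP; split=> [w [j _ []]//|w Sw]; exists (q w).
Qed.

Lemma integral_partition_close (f : T -> R) (c : J -> R) (eta : R) :
  measurable_fun S f -> 0 <= eta -> (forall j, 0 <= c j) ->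
  (forall s, S s -> 0 <= f s) -> (forall s, S s -> `|f s - c (q s)| <= eta) ->
  `|fine (\int[mu]_(s in S) (f s)%:E) - \sum_j c j * fine (mu (cell j))| <= eta * V.
Proof.
move=> mf eta0 c0 f0 fc.
have SE : S = \big[setU/set0]_(j <- enum J) cell j.
  rewrite big_enum -(bigcup_pred J cell).
  by apply/seteqP; split=> [w Sw|w [j _ []]//]; exists (q w).
have cl j : exists2 y : R, (\int[mu]_(s in cell j) (f s)%:E)%E = y%:E &
    `|y - c j * fine (mu (cell j))| <= eta * fine (mu (cell j)).
  apply: integral_close => //.
  - exact: measure_cellE.
  - by apply: measurable_funS mf => //; exact: subIsetl.
  - by move=> s [Ss _]; exact: f0.
  - by move=> s [Ss <-]; exact: fc.
have [y yE yc] : exists2 y : J -> R, (forall j, (\int[mu]_(s in cell j) (f s)%:E)%E = (y j)%:E) &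
    (forall j, `|y j - c j * fine (mu (cell j))| <= eta * fine (mu (cell j))).
  exists (fun j => projT1 (cid2 (cl j))) => j; first by case: (cid2 (cl j)).
  by case: (cid2 (cl j)).
have -> : (\int[mu]_(s in S) (f s)%:E)%E = (\sum_j y j)%:E.
  rewrite {1}SE ge0_integral_bigsetU//=.
  - by rewrite big_enum/= -sumEFin; apply: eq_bigr => j _.
  - exact: enum_uniq.
  - by move=> i j _ _ [w [[_ <-] [_ <-]]].
  - by rewrite -SE; exact/measurable_EFinP.
  - by move=> w; rewrite -SE => Sw; rewrite lee_fin f0.
rewrite /= -sumrB; apply: le_trans (ler_norm_sum _ _ _) _.
by rewrite -measure_cell_sum mulr_sumr; exact: ler_sum.
Qed.

End Partition.

End Measures.

Lemma measurable_bigmax (R : realType) (disp : measure_display) (T : measurableType disp)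
    (A : set T) (I : Type) (s : seq I) (F0 : T -> R) (F : I -> T -> R) :
  measurable_fun A F0 -> (forall i, measurable_fun A (F i)) ->
  measurable_fun A (fun x => \big[Num.max/F0 x]_(i <- s) F i x).
Proof.
move=> m0 mF; elim: s => [|i s ih].
  by rewrite (_ : (fun x => _) = F0)//; apply/funext => x; rewrite big_nil.
rewrite (_ : (fun x => _) = F i \max (fun x => \big[Num.max/F0 x]_(i <- s) F i x)).
  exact: measurable_maxr.
by apply/funext => x; rewrite big_cons.
Qed.

(** * From the continuous problem to the finite model *)

Section Discretization.
Variables (R : realType) (d m D N alpha : nat).
Variables (S : set 'cV[R]_d) (lam : {measure set (Rd R d) -> \bar R}) (gamma dt : R).
Variables (r : 'cV[R]_d -> 'I_(2 ^ alpha) -> R).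
Variables (gt : 'cV[R]_d -> 'I_(2 ^ alpha) -> R -> 'cV[R]_d).
Hypothesis d0 : (0 < d)%N.
Hypothesis lam_box : lebesgue_on_boxes lam.
Hypothesis S01 : forall s, S s -> forall i, 0 <= s i 0 <= 1.
Hypothesis cS : compact S.
Hypothesis lamS_gt0 : (0 < lam (S : set (Rd R d)))%E.
Hypothesis gamma01 : 0 < gamma < 1.
Hypothesis cr : forall a, {within S, continuous (fun s => r s a)}.
Hypothesis r1 : forall s a, S s -> `|r s a| <= 1.
Hypothesis gtS : forall s a t, S s -> 0 <= t -> S (gt s a t).
Hypothesis dt01 : 0 < dt < 1.
Hypothesis mgt : forall a,
  measurable_fun (S : set (Rd R d)) (fun s : Rd R d => gt s a dt : Rd R d).

Let SR : set (Rd R d) := S.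
Let mS : measurable SR. Proof. exact: compact_measurable_Rd. Qed.

Let S1 s j : S s -> `|s j 0| <= 1.
Proof. by move=> /S01/(_ j)/andP[h0 h1]; rewrite ger0_norm. Qed.

Let gt1 s a : S s -> S (gt s a dt).
Proof. by move=> Ss; apply: gtS => //; case/andP: dt01 => /ltW. Qed.

Let coord_measurable j : measurable_fun setT (fun s : Rd R d => (s : 'cV[R]_d) j 0).
Proof. by apply: continuous_measurable_Rd; exact: coord_continuous. Qed.

Lemma lam_finite : exists2 V : R, 0 < V & lam SR = V%:E.
Proof.
pose box : set (Rd R d) :=
  [set x : Rd R d | forall i, (0 : 'cV[R]_d) i 0 <= x i 0 <= (const_mx 1 : 'cV[R]_d) i 0].
have boxE : lam box = 1%E.
  rewrite /box lam_box => [|i]; last by rewrite !mxE.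
  by rewrite big1// => i _; rewrite !mxE subr0.
have mbox : measurable box.
  have -> : box = \bigcap_(i in [set: 'I_d])
      (fun s : Rd R d => (s : 'cV[R]_d) i 0) @^-1` `[0, 1]%classic.
    apply/seteqP; split=> s h i; first by move=> _; have := h i; rewrite !mxE /= in_itv.
    by have := h i Logic.I; rewrite /= in_itv/= !mxE.
  apply: fin_bigcap_measurable => // i _; rewrite -[_ @^-1` _]setTI.
  by apply: coord_measurable => //; exact: measurable_itv.
have le1 : (lam SR <= 1)%E.
  rewrite -boxE; apply: le_measure; rewrite ?inE// => s Ss i.
  by rewrite !mxE; exact: S01.
have fin : lam SR \is a fin_num by rewrite ge0_fin_numE// (le_lt_trans le1)// ltry.
exists (fine (lam SR)); last by rewrite fineK.
by rewrite fine_gt0// lamS_gt0 (le_lt_trans le1)// ltry.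
Qed.

Let S_nonempty : exists s, S s.
Proof.
apply: contrapT => h; have S0 : SR = set0 by apply/seteqP; split=> s Ss //; apply: h; exists s.
by move: lamS_gt0; rewrite -/SR S0 measure0 ltxx.
Qed.

(** Next states and rewards are listed for every action, so that one partition of [S] serves all
    actions and two states of a cell have close next states by construction. *)
Let feature_index : finType := ('I_d + ('I_(2 ^ alpha) + 'I_(2 ^ alpha) * 'I_d))%type.

Let feature (k : feature_index) (s : Rd R d) : R :=
  match k with
  | inl j => (s : 'cV[R]_d) j 0
  | inr (inl a) => r s a
  | inr (inr (a, j)) => gt s a dt j 0
  end.

Let mfeature k : measurable_fun SR (feature k).
Proof.
case: k => [j|[a|[a j]]] /=.
- exact: (measurable_funTS (coord_measurable j)).
- exact: (within_continuous_measurable_Rd mS (@cr a)).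
- exact: (measurableT_comp (coord_measurable j) (mgt a)).
Qed.

Let feature1 k s : SR s -> `|feature k s| <= 1.
Proof.
case: k => [j|[a|[a j]]] Ss /=; [exact: S1|exact: r1|].
by apply: S1; exact: gt1.
Qed.

Variable h : nat.
Hypothesis h0 : (0 < h)%N.

Definition label : finType := {ffun feature_index -> 'I_(2 * h).+1}.
Definition label_of : Rd R d -> label := quantize feature h.
Definition cell (c : label) : set (Rd R d) := SR `&` label_of @^-1` [set c].

Lemma measurable_cell c : measurable (cell c).
Proof. exact: (measurable_quantize h0 mS mfeature feature1 c). Qed.

(* The fallback point is only used for empty cells, which have weight 0. *)
Definition representative (c : label) : 'cV[R]_d :=
  if pselect (exists s, cell c s) is left e then projT1 (cid e) else projT1 (cid S_nonempty).

Lemma representative_in c : S (representative c).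
Proof.
rewrite /representative; case: pselect => [e|_]; last exact: (projT2 (cid S_nonempty)).
by case: (projT2 (cid e)).
Qed.

Lemma representative_cell s : S s -> cell (label_of s) (representative (label_of s)).
Proof.
move=> Ss; rewrite /representative; case: pselect => [e|[]]; first exact: (projT2 (cid e)).
by exists s.
Qed.

Lemma representative_close k s : S s ->
  `|feature k s - feature k (representative (label_of s))| <= h%:R^-1.
Proof.
move=> Ss; have [Sr lr] := representative_cell Ss.
by apply: (quantize_close h0 feature1).
Qed.

Let X : finType := (label * 'I_(2 ^ alpha))%type.

Definition point (x : X) := representative x.1.
Definition action (x : X) := x.2.
Definition next_point (x : X) := gt (representative x.1) x.2 dt.
Definition point_reward (x : X) := r (representative x.1) x.2.

Lemma point1 x j : `|point x j 0| <= 1.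
Proof. by apply: S1; exact: representative_in. Qed.

Lemma next_point1 x j : `|next_point x j 0| <= 1.
Proof. by apply: S1; apply: gt1; exact: representative_in. Qed.

Lemma point_reward1 x : `|point_reward x| <= 1.
Proof. by apply: r1; exact: representative_in. Qed.

Let V : R := fine (lam SR).
Let V_gt0 : 0 < V.
Proof. by rewrite /V; have [v v0 ->] := lam_finite. Qed.
Let lamSE : lam SR = V%:E.
Proof. by rewrite /V; have [v v0 ->] := lam_finite. Qed.
Let K : R := (2 ^ alpha)%:R.
Let K_gt0 : 0 < K. Proof. by rewrite /K ltr0n expn_gt0. Qed.

Definition weight (x : X) : R := fine (lam (cell x.1)) / V * K^-1.

Lemma weight_ge0 x : 0 <= weight x.
Proof. by rewrite /weight mulr_ge0 ?divr_ge0 ?invr_ge0 ?(ltW V_gt0) ?(ltW K_gt0)// fine_ge0. Qed.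

Lemma weight_sum : \sum_x weight x = 1.
Proof.
rewrite -(pair_bigA _ (fun c a => weight (c, a)))/= /weight /=.
under eq_bigr do rewrite sumr_const card_ord -mulr_natl mulrCA mulfV ?gt_eqF// mulr1.
rewrite -mulr_suml (measure_cell_sum mS measurable_cell lamSE) mulfV// gt_eqF//.
Qed.

Let loss x (Th : act_family R d m D N alpha) :=
  td_error gamma Th (point x) (action x) (point_reward x) (next_point x) ^+ 2 / 2.

Lemma bellman_sq_close B (Th : act_family R d m D N alpha) s a :
  0 <= B -> small_family B Th -> S s ->
  `|bellman_sq gamma dt r gt Th s a - 2 * loss (label_of s, a) Th| <=
     2 * (2 * B + 1) ^+ 2 / h%:R.
Proof.
move=> B0 ThB Ss; set c := label_of s.
have -> : 2 * loss (c, a) Th =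
  td_error gamma Th (point (c, a)) a (point_reward (c, a)) (next_point (c, a)) ^+ 2.
  by rewrite /loss /action /=; field.
have -> : bellman_sq gamma dt r gt Th s a = td_error gamma Th s a (r s a) (gt s a dt) ^+ 2 by [].
set M := 2 * B + 1; have M0 : 0 <= 2 * M by rewrite /M; lra.
have Sg := gt1 a Ss.
apply: le_trans (sqr_dist_le (M := M) _ _) _.
- by apply: td_error_bound ThB _ _ _ => // [j|j|]; [exact: S1|exact: S1|exact: r1].
- apply: td_error_bound ThB _ _ _ => // [j|j|]; [exact: point1|exact: next_point1|].
  exact: point_reward1.
have -> : 2 * M ^+ 2 / h%:R = 2 * M * (M * h%:R^-1) by ring.
rewrite ler_wpM2l//; apply: td_error_lip ThB _ _ _ => //.
- by move=> j; exact: (representative_close (inl j) Ss).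
- by move=> j; exact: (representative_close (inr (inr (a, j))) Ss).
- exact: (representative_close (inr (inl a)) Ss).
Qed.

Lemma bellman_sq_measurable (Th : act_family R d m D N alpha) a :
  measurable_fun SR (fun s : Rd R d => bellman_sq gamma dt r gt Th s a).
Proof.
have mres b : measurable_fun setT (resnet (Th b) : Rd R d -> R).
  apply: continuous_measurable_Rd.
  exact: gauge_continuous d0 (path_norm_ge0 _) (gauge_resnet d0 (Th b)).
apply: measurable_funX; apply: measurable_funB.
  apply: measurable_funB; first exact: measurable_funTS.
  exact: within_continuous_measurable_Rd.
apply: measurable_funM; first exact: measurable_cst.
apply: (measurableT_comp (f := max_Q Th : Rd R d -> R)) (mgt a).
by apply: measurable_bigmax => *; exact: mres.
Qed.

Lemma risk_D_close B (Th : act_family R d m D N alpha) : 0 <= B -> small_family B Th ->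
  `|risk_D S lam gamma dt r gt Th - \sum_x weight x * loss x Th| <= (2 * B + 1) ^+ 2 / h%:R.
Proof.
move=> B0 ThB; set M := 2 * B + 1.
have h0' : 0 < h%:R :> R by rewrite ltr0n.
have eta0 : 0 <= 2 * M ^+ 2 / h%:R by rewrite divr_ge0// mulr_ge0// sqr_ge0.
pose y a := fine (\int[lam]_(s in SR) (bellman_sq gamma dt r gt Th s a)%:E).
pose z a := \sum_c 2 * loss (c, a) Th * fine (lam (cell c)).
have yz a : `|y a - z a| <= 2 * M ^+ 2 / h%:R * V.
  apply: (integral_partition_close mS measurable_cell lamSE) => //.
  - exact: bellman_sq_measurable.
  - by move=> c; rewrite mulr_ge0// divr_ge0// sqr_ge0.
  - by move=> s _; exact: sqr_ge0.
  - by move=> s Ss; exact: bellman_sq_close.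
have -> : \sum_x weight x * loss x Th = 2^-1 * (K^-1 * \sum_a V^-1 * z a).
  rewrite -(pair_bigA _ (fun c a => weight (c, a) * loss (c, a) Th))/= exchange_big/= !mulr_sumr.
  apply: eq_bigr => a _; rewrite /z !mulr_sumr; apply: eq_bigr => c _.
  by rewrite /weight /=; field; rewrite !gt_eqF.
have -> : risk_D S lam gamma dt r gt Th = 2^-1 * (K^-1 * \sum_a V^-1 * y a) by [].
rewrite -!mulrBr -sumrB !normrM !normfV (gtr0_norm K_gt0) [`|2|]gtr0_norm//.
have -> : M ^+ 2 / h%:R = 2^-1 * (K^-1 * (K * (2 * M ^+ 2 / h%:R))) by field; rewrite !gt_eqF.
rewrite ler_pM2l ?invr_gt0// ler_pM2l ?invr_gt0//.
apply: le_trans (ler_norm_sum _ _ _) _.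
have -> : K * (2 * M ^+ 2 / h%:R) = \sum_(a < 2 ^ alpha) (2 * M ^+ 2 / h%:R).
  by rewrite sumr_const card_ord /K mulr_natl.
apply: ler_sum => a _; rewrite -mulrBr normrM normfV (gtr0_norm V_gt0).
by rewrite ler_pdivrMl// mulrC.
Qed.

Section Sample.
Variables (n : nat) (dO : measure_display) (Omega : measurableType dO) (P : probability Omega R).
Variables (ss : 'I_n -> Omega -> Rd R d) (aa : 'I_n -> Omega -> 'I_(2 ^ alpha)).
Hypothesis n0 : (0 < n)%N.
Hypothesis iid : iid_sample P S lam ss aa.

(** Membership in [S] is part of [cell], so samples leaving [S] belong to no event. These disjoint
    events still have total probability 1, as the weights sum to 1. *)
Definition sample_event (t : n.-tuple X) : set Omega :=
  [set w | forall i, cell (tnth t i).1 (ss i w) /\ [set (tnth t i).2] (aa i w)].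

Lemma measurable_sample_event t : measurable (sample_event t).
Proof.
case: iid => mss maa _ _ _.
have -> : sample_event t = \bigcap_(i in [set: 'I_n])
   (ss i @^-1` cell (tnth t i).1 `&` aa i @^-1` [set (tnth t i).2]).
  by apply/seteqP; split=> w hw i; [move=> _; exact: hw|exact: (hw i Logic.I)].
apply: fin_bigcap_measurable => // i _; apply: measurableI => //.
by rewrite -[_ @^-1` _]setTI; apply: mss => //; exact: measurable_cell.
Qed.

Lemma sample_event_prob t : P (sample_event t) = (\prod_(i < n) weight (tnth t i))%:E.
Proof.
case: iid => _ _ Pss Paa Pind.
rewrite /sample_event (Pind (fun i => cell (tnth t i).1) (fun i => [set (tnth t i).2])).
  rewrite -prodEFin; apply: eq_bigr => i _.
  rewrite Pss; last exact: measurable_cell.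
  by rewrite Paa -EFinM (setIidl (B := S)) //; exact: subIsetl.
by move=> i; exact: measurable_cell.
Qed.

Lemma sample_event_inj s t w : sample_event s w -> sample_event t w -> s = t.
Proof.
move=> sw tw; apply: eq_from_tnth => i.
have [[_ s1] s2] := sw i; have [[_ t1] t2] := tw i.
by rewrite (surjective_pairing (tnth s i)) (surjective_pairing (tnth t i)) -s1 -s2 -t1 -t2.
Qed.

Lemma risk_S_close B (Th : act_family R d m D N alpha) t w : 0 <= B -> small_family B Th ->
  sample_event t w ->
  `|risk_S gamma dt r gt (fun i => ss i w) (fun i => aa i w) Th -
     n%:R^-1 * \sum_(x <- t) loss x Th| <= (2 * B + 1) ^+ 2 / h%:R.
Proof.
move=> B0 ThB tw; have n0' : 0 < n%:R :> R by rewrite ltr0n.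
have h0' : 0 < h%:R :> R by rewrite ltr0n.
rewrite big_tuple /risk_S.
have -> : (2 * n%:R)^-1 * \sum_(i < n) bellman_sq gamma dt r gt Th (ss i w) (aa i w) -
    n%:R^-1 * \sum_(i < n) loss (tnth t i) Th =
  (2 * n%:R)^-1 * \sum_(i < n)
    (bellman_sq gamma dt r gt Th (ss i w) (aa i w) - 2 * loss (tnth t i) Th).
  by rewrite sumrB -mulr_sumr; field; rewrite gt_eqF.
have nn : 0 < 2 * n%:R :> R by rewrite mulr_gt0.
rewrite normrM normfV (gtr0_norm nn) ler_pdivrMl//.
apply: le_trans (ler_norm_sum _ _ _) _.
have -> : 2 * n%:R * ((2 * B + 1) ^+ 2 / h%:R) = \sum_(i < n) (2 * (2 * B + 1) ^+ 2 / h%:R).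
  by rewrite sumr_const card_ord -mulr_natl; ring.
apply: ler_sum => i _; have [[Si si] ai] := tw i.
have -> : tnth t i = (label_of (ss i w), aa i w).
  by rewrite (surjective_pairing (tnth t i)) -si -ai.
exact: bellman_sq_close.
Qed.

(** Goodness depends on the cells alone, so the event is a finite disjoint union of sample events:
    it is measurable, and its probability is the total weight of the good tuples. *)
Lemma sample_event_good (good : seq X -> bool) (delta : R) :
  iid_mean weight n (fun s => (~~ good s)%:R) <= delta ->
  let E := [set w | exists2 t : n.-tuple X, good t & sample_event t w] in
  measurable E /\ (P E >= (1 - delta)%:E)%E.
Proof.
move=> Hbad E; split.
  have -> : E = \bigcup_(t in [set` (fun t : n.-tuple X => good t)]) sample_event t by [].
  apply: fin_bigcup_measurable; first exact: finite_finset.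
  by move=> t _; exact: measurable_sample_event.
rewrite /E measure_big_disjoint; last 2 first.
- exact: measurable_sample_event.
- exact: sample_event_inj.
rewrite (eq_bigr (fun t : n.-tuple X => (\prod_(i < n) weight (tnth t i))%:E)); last first.
  by move=> t _; exact: sample_event_prob.
rewrite sumEFin lee_fin lerBlDr; apply: le_trans (lerD (lexx _) Hbad).
have T1 : \sum_(t : n.-tuple X) \prod_(i < n) weight (tnth t i) = 1.
  by rewrite -[RHS](iid_mean_cst weight_sum n) iid_mean_tuple; apply: eq_bigr => t _; rewrite mulr1.
rewrite iid_mean_tuple -[leLHS]T1 [X in _ <= X + _]big_mkcond -big_split/=.
apply: ler_sum => t _.
by case: (good t) => /=; rewrite ?mulr0 ?mulr1 ?addr0 ?add0r.
Qed.

Lemma exists_good_event (delta : R) : 0 < delta < 1 ->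
  exists E : set Omega, [/\ measurable E, (P E >= (1 - delta)%:E)%E &
    forall w, E w -> forall (Th : act_family R d m D N alpha) (B : R),
      B = (Num.truncn (family_path_norm Th)).+1%:R ->
      `|risk_D S lam gamma dt r gt Th -
        risk_S gamma dt r gt (fun i => ss i w) (fun i => aa i w) Th| <=
      deviation_threshold d alpha n delta B / n%:R + 2 * ((2 * B + 1) ^+ 2 / h%:R)].
Proof.
move=> delta01; have n0' : 0 < n%:R :> R by rewrite ltr0n.
pose bad k (s : seq X) := exists2 Th : act_family R d m D N alpha, small_family k.+1%:R Th &
  deviation_threshold d alpha n delta k.+1%:R <=
  `|\sum_(x <- s) ((\sum_y weight y * loss y Th) - loss x Th)|.
pose good s := ~~ `[< exists k : nat, `[< bad k s >] >].
have := finite_generalization m D N d0 gamma01 weight_ge0 weight_sum action point1 next_point1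
  point_reward1 n0 delta01.
have -> : iid_mean weight n (fun s => `[< exists k : nat, `[< bad k s >] >]%:R) =
    iid_mean weight n (fun s => (~~ good s)%:R).
  by congr iid_mean; apply/funext => s; rewrite negbK.
move=> /sample_event_good[mE PE].
exists [set w | exists2 t : n.-tuple X, good t & sample_event t w]; split=> // w [t gt0 tw] Th B BE.
have Q0 := family_path_norm_ge0 Th.
have B0 : 0 <= B by rewrite BE.
have ThB : small_family B Th by rewrite BE; apply/ltW; exact: truncnS_gt.
(* A good tuple is bad at no level, in particular not at the level just above the path norm of
   [Th]. *)
have dev : `|\sum_(x <- t) ((\sum_y weight y * loss y Th) - loss x Th)| <
    deviation_threshold d alpha n delta B.
  rewrite ltNge; apply: contraNN gt0 => le; apply/asboolP.
  by exists (Num.truncn (family_path_norm Th)); apply/asboolP; exists Th; rewrite -BE.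
have rD := risk_D_close B0 ThB; have rS := risk_S_close B0 ThB tw.
set mean := \sum_y _ in dev rD.
have dev' : `|mean - n%:R^-1 * \sum_(x <- t) loss x Th| <=
    deviation_threshold d alpha n delta B / n%:R.
  rewrite ler_pdivlMr// -[X in _ * X](gtr0_norm n0') -normrM mulrBl mulrAC mulVf ?gt_eqF// mul1r.
  apply: le_trans (ltW dev); rewrite sumrB big_const_seq count_predT size_tuple iter_addr_0.
  by rewrite mulr_natr.
by move: rD rS dev'; rewrite !ler_norml; lra.
Qed.

End Sample.

End Discretization.

Unset Implicit Arguments.

Theorem theorem3p6 (R : realType) (d m D L alpha : nat)
  (S : set 'cV[R]_d) (lam : {measure set (Rd R d) -> \bar R})
  (gamma dt : R) (r : 'cV[R]_d -> 'I_(2 ^ alpha) -> R)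
  (gt : 'cV[R]_d -> 'I_(2 ^ alpha) -> R -> 'cV[R]_d) :
  (0 < d)%N -> (0 < m)%N -> (0 < D)%N -> (0 < L)%N ->
  lebesgue_on_boxes lam ->
  (forall s, S s -> forall i, 0 <= s i 0 <= 1) ->
  compact S ->
  (0 < lam (S : set (Rd R d)))%E ->
  0 < gamma < 1 ->
  (forall a, {within S, continuous (fun s => r s a)}) ->
  (forall s a, S s -> `|r s a| <= 1) ->
  (forall s a t, S s -> 0 <= t -> S (gt s a t)) ->
  0 < dt < 1 ->
  (forall a, measurable_fun (S : set (Rd R d)) (fun s : Rd R d => gt s a dt : Rd R d)) ->
  forall (delta : R), 0 < delta < 1 ->
  forall (n : nat), (0 < n)%N ->
  forall (dO : measure_display) (Omega : measurableType dO)
    (P : probability Omega R)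
    (ss : 'I_n -> Omega -> Rd R d) (aa : 'I_n -> Omega -> 'I_(2 ^ alpha)),
  iid_sample P S lam ss aa ->
  exists E : set Omega,
    [/\ measurable E, (P E >= (1 - delta)%:E)%E &
        forall w, E w ->
        forall Th : act_family R d m D L alpha,
          `|risk_D S lam gamma dt r gt Th
            - risk_S gamma dt r gt (fun i => ss i w) (fun i => aa i w) Th|
          <= gen_bound d alpha n delta (family_path_norm Th)].
Proof.
move=> d0 _ _ _ lam_box S01 cS lamS gamma01 cr r1 gtS dt01 mgt.
move=> delta delta01 n n0 dO Omega P ss aa iid.
(* With mesh [1 / (40 n)] the two risks together move by [M^2 / (20 n)], the amount reserved in
   [deviation_threshold_le]. *)
have h0 : (0 < 40 * n)%N by rewrite muln_gt0.
have [E [mE PE HE]] := exists_good_event m D L d0 lam_box S01 cS lamS gamma01 cr r1 gtS dt01 mgt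
  h0 n0 iid delta01.
exists E; split=> // w Ew Th; apply: le_trans (HE w Ew Th _ erefl) _.
have Q0 := family_path_norm_ge0 Th.
rewrite natrM; apply: deviation_threshold_le => //.
  by rewrite ler1n.
rewrite -natr1 lerD2r.
by have /andP[] := truncn_itv Q0.
Qed.
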